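(* Let $\mathfrak{n}$ be a filiform Lie algebra (finite-dimensional over $\mathbb{C}$) of non-zero rank, and put $n=\dim\mathfrak{n}$. Then $\mathfrak{n}$ is completable if and only if it is isomorphic to $L_{n}$, to $Q_{n}$, to an algebra $A_{n}^{k}(\lambda_{1},\dots,\lambda_{t-1})$, or to an algebra $B_{n}^{k}(\lambda_{1},\dots,\lambda_{t-1})$, for some admissible $k$ and parameters $\lambda_i$ (these algebras are defined in the context).
   Context: All Lie algebras are finite-dimensional over $\mathbb{C}$. Complete: a Lie algebra $\mathfrak{g}$ is complete if $H^{0}(\mathfrak{g},\mathfrak{g})=H^{1}(\mathfrak{g},\mathfrak{g})=\{0\}$ (adjoint cohomology), i.e. its center is zero and every derivation is inner. Torus, rank, completable: for a nilpotent Lie algebra $\mathfrak{n}$, a maximal torus $\mathfrak{t}\subset \mathrm{Der}(\mathfrak{n})$ is an abelian subalgebra consisting of semisimple (diagonalizable) derivations that is maximal for inclusion among such subalgebras. The rank of $\mathfrak{n}$ is $\dim\mathfrak{t}$. The algebra $\mathfrak{n}$ is completable if the semidirect product $\mathfrak{n}\oplus\mathfrak{t}$ (with $[h,X]=h(X)$ for $h\in\mathfrak{t}$, $X\in\mathfrak{n}$) is complete, where $\mathfrak{t}$ is a maximal torus of derivations of $\mathfrak{n}$. Filiform: for $Y\in\mathfrak{n}\setminus[\mathfrak{n},\mathfrak{n}]$ let $c(Y)$ be the non-increasing sequence of sizes of the Jordan blocks of the nilpotent operator $\mathrm{ad}\,Y$; the characteristic sequence $c(\mathfrak{n})$ is the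 maximum of the $c(Y)$ in lexicographic order. An $n$-dimensional nilpotent Lie algebra is filiform if $c(\mathfrak{n})=(n-1,1)$. Algebras (basis $Y_1,\dots,Y_n$; brackets not listed and not following by antisymmetry are zero; $[x]$ denotes the integer part of $x$): $L_n$: $[Y_1,Y_j]=Y_{j+1}$ for $j=2,\dots,n-1$. $Q_n$, where $n=2p$ is even: $[Y_1,Y_j]=Y_{j+1}$ for $j=2,\dots,n-1$, and $[Y_i,Y_{n-i+1}]=(-1)^{i+1}Y_n$ for $i=2,\dots,p$. $A_{n}^{k}(\lambda_{1},\dots,\lambda_{t-1})$, where $2\le k\le n-3$ and $t=\left[\frac{n-k+1}{2}\right]$: - $[Y_1,Y_i]=Y_{i+1}$ for $i=2,\dots,n-1$; - $[Y_i,Y_{i+1}]=\lambda_{i-1}Y_{2i+k-1}$ for $2\le i\le t$; - $[Y_i,Y_j]=a_{ij}Y_{i+j+k-2}$ for $2\le i\le j$, $i+j+k-2\le n$. $B_{n}^{k}(\lambda_{1},\dots,\lambda_{t-1})$, where $n=2m$ is even, $2\le k\le n-3$ and $t=\left[\frac{n-k}{2}\right]$: - $[Y_1,Y_i]=Y_{i+1}$ for $i=2,\dots,n-2$; - $[Y_i,Y_{n-i+1}]=(-1)^{i+1}Y_n$ for $i=2,\dots,n-1$; - $[Y_i,Y_{i+1}]=\lambda_{i-1}Y_{2i+k-1}$ for $i=2,\dots,t$; - $[Y_i,Y_j]=a_{ij}Y_{i+j+k-2}$ for $2\le i,j\le n-2$, $i+j+k-2\le n-1$, $j\ne i+1$.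 In the families $A$ and $B$ the $\lambda_i\in\mathbb{C}$ are not all zero and satisfy the polynomial equations expressing the Jacobi identity, and the constants $a_{ij}$ (antisymmetric in $i,j$) satisfy $a_{ij}=a_{i,j+1}+a_{i+1,j}$ (whenever the constants involved occur) and $a_{i,i+1}=\lambda_{i-1}$. *)

(* Defs.v *)
From HB Require Import structures.
From mathcomp Require Import all_boot all_order all_algebra ssrAC.
From mathcomp Require Import reals complex.
From mathcomp Require Import zify ring.

Set Implicit Arguments.
Unset Strict Implicit.
Unset Printing Implicit Defensive.

Import Order.TTheory GRing.Theory Num.Theory.
Local Open Scope ring_scope.

HB.mixin Record Vector_isLie (K : fieldType) L of Vector K L := {
  lie : L -> L -> L;
  lie_linearl : forall y, linear (lie ^~ y);
  lie_linearr : forall x, linear (lie x);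
  liexx : forall x, lie x x = 0;
  lie_jacobi : forall x y z,
    lie x (lie y z) + lie y (lie z x) + lie z (lie x y) = 0
}.

#[short(type="lieAlgType")]
HB.structure Definition LieAlgebra (K : fieldType) :=
  {L of Vector_isLie K L & Vector K L}.

Notation "⁅ x , y ⁆" := (lie x y) (at level 0, format "⁅ x ,  y ⁆") : ring_scope.

HB.instance Definition _ (K : fieldType) (L : lieAlgType K) (x : L) :=
  GRing.isLinear.Build K L L _ (lie x) (lie_linearr x).

Definition isomorphic (K : fieldType) (L M : lieAlgType K) : Prop :=
  exists2 f : {linear L -> M}, bijective f & {morph f : x y / ⁅x, y⁆ >-> ⁅x, y⁆}.

Notation "L ≅ M" := (isomorphic L M) (at level 70, no associativity).

Section LieTheory.
Variables (K : fieldType) (L : lieAlgType K).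
Implicit Types (x y : L) (U V : {vspace L}) (D : 'End(L)) (s : seq nat).

Definition ad x : 'End(L) := linfun (lie x).

Definition derivation D : Prop := forall x y, D ⁅x, y⁆ = ⁅D x, y⁆ + ⁅x, D y⁆.

Definition complete : Prop :=
  (forall x, (forall y, ⁅x, y⁆ = 0) -> x = 0) /\
  (forall D, derivation D -> exists x, D = ad x).

Definition lie_prod U V : {vspace L} :=
  <<[seq ⁅x, y⁆ | x <- vbasis U, y <- vbasis V]>>%VS.

Definition derived : {vspace L} := lie_prod fullv fullv.

Definition lower_central (m : nat) : {vspace L} :=
  iter m (lie_prod fullv) fullv.

Definition nilpotent : Prop := exists m, lower_central m = 0%VS.

(* The sequence s lists, in non-increasing order, the sizes of the Jordan
   blocks of the nilpotent operator f: there are vectors v_0, v_1, ..., one per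
   block, such that the v_i, f v_i, ..., f^(s_i - 1) v_i together form a basis
   and f^(s_i) v_i = 0. *)
Definition jordan_sizes (f : 'End(L)) s : Prop :=
  [/\ sorted geq s, all (leq 1) s &
   exists v : seq L,
     [/\ size v = size s,
         basis_of fullv
           (flatten [seq [seq iter j f p.1 | j <- iota 0 p.2] | p <- zip v s]) &
         forall p, p \in zip v s -> iter p.2 f p.1 = 0]].

(* [seqlexi nat] is [seq nat] with its lexicographic order. *)
Definition char_seq s : Prop :=
  (exists2 Y, Y \notin derived & jordan_sizes (ad Y) s) /\
  (forall Y s', Y \notin derived -> jordan_sizes (ad Y) s' ->
     ((s' : seqlexi nat) <= (s : seqlexi nat))%O).

Definition filiform : Prop :=
  nilpotent /\ char_seq [:: (\dim {:L}).-1; 1%N].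

Definition diagonalizable_end D : Prop :=
  exists2 b : seq L, basis_of fullv b &
    forall v, v \in b -> exists a : K, D v = a *: v.

Definition is_torus (t : {vspace 'End(L)}) : Prop :=
  [/\ forall D, D \in t -> derivation D,
      forall D, D \in t -> diagonalizable_end D &
      forall D D', D \in t -> D' \in t -> (D \o D' = D' \o D)%VF].

Record torus := Torus {
  torus_space :> {vspace 'End(L)};
  torusP : is_torus torus_space
}.

Definition maximal_torus (t : torus) : Prop :=
  forall t' : torus, (t <= t')%VS -> (t' <= t)%VS.

(* Over an algebraically closed field of characteristic 0 the maximal tori are
   conjugate under the automorphism group, so that neither the rank nor
   completability depends on the choice of the maximal torus. *)
Definition has_rank (r : nat) : Prop :=
  exists2 t : torus, maximal_torus t & \dim t = r.

End LieTheory.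

Fact lieC (K : fieldType) (L : lieAlgType K) (x y : L) : ⁅x, y⁆ = - ⁅y, x⁆.
Proof.
apply/eqP; rewrite -addr_eq0; apply/eqP; have := liexx (x + y).
have -> : ⁅x + y, x + y⁆ = ⁅x, x + y⁆ + ⁅y, x + y⁆.
  by have := lie_linearl (x + y) 1 x y; rewrite !scale1r.
by rewrite !linearD /= !liexx add0r addr0.
Qed.

Local Fact jacobi_terms (V : zmodType) (a1 a2 a3 p q r s u v d e f : V) :
  a1 + a2 + a3 = 0 ->
  a1 + p - q + (- r + s + d - e) + (a2 + u - s + (- p + v + f - d))
  + (a3 + r - v + (- u + q + e - f)) = 0.
Proof.
move=> a0; rewrite !addrA.
rewrite [LHS](ACl ((1*8*15)*(2*11)*(19*3)*(16*4)*(5*10)*(6*14)*(20*7)*(9*18)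
                   *(12*17)*(13*21))%AC) /=.
by rewrite a0 !subrr !addr0.
Qed.

Section Semidirect.
Variables (K : fieldType) (L : lieAlgType K) (t : torus L).

Definition semidirect : Type := (L * subvs_of t)%type.

HB.instance Definition _ := Vector.on semidirect.

(* [X + h, Y + h'] = [X, Y] + h(Y) - h'(X), as t is abelian. *)
Definition semidirect_lie (x y : semidirect) : semidirect :=
  (⁅x.1, y.1⁆ + vsval x.2 y.1 - vsval y.2 x.1, 0).

Fact semidirect_lieC x y : semidirect_lie x y = - semidirect_lie y x.
Proof.
rewrite /semidirect_lie; apply/pair_equal_spec => /=; split; last by rewrite oppr0.
by rewrite lieC !opprD opprK -!addrA; congr (_ + _); rewrite addrC.
Qed.

Fact semidirect_linearl y : linear (semidirect_lie ^~ y).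
Proof.
move=> a [x1 h1] [x2 h2]; rewrite /semidirect_lie; congr pair => /=; last first.
  by rewrite scaler0 addr0.
rewrite (lie_linearl y.1) linearP add_lfunE scale_lfunE.
by rewrite opprD !scalerBr !scalerDr /= (addrACA (a *: _)) [LHS]addrACA.
Qed.

Fact semidirect_linearr x : linear (semidirect_lie x).
Proof.
move=> a y1 y2; rewrite semidirect_lieC semidirect_linearl.
by rewrite opprD -scalerN -!semidirect_lieC.
Qed.

Fact semidirect_liexx x : semidirect_lie x x = 0.
Proof. by rewrite /semidirect_lie liexx add0r subrr. Qed.

Fact semidirect_jacobi x y z :
  semidirect_lie x (semidirect_lie y z) + semidirect_lie y (semidirect_lie z x)
  + semidirect_lie z (semidirect_lie x y) = 0.
Proof.
have [der _ com] := torusP t.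
move: x y z => [x h1] [y h2] [z h3]; rewrite /semidirect_lie.
apply/pair_equal_spec => /=; split; last by rewrite !addr0.
rewrite !lfunE /= !linearD !linearN /= !subr0 !(der _ (valP _)).
have cE D D' v : D \in t -> D' \in t -> D (D' v) = D' (D v).
  by move=> tD tD'; rewrite -!comp_lfunE (com D D').
rewrite (cE _ _ _ (valP h2) (valP h1)) (cE _ _ _ (valP h3) (valP h1)).
rewrite (cE _ _ _ (valP h3) (valP h2)).
rewrite (lieC (\val h1 y)) (lieC (\val h2 z)) (lieC (\val h3 x)).
exact: jacobi_terms (lie_jacobi x y z).
Qed.

HB.instance Definition _ := Vector_isLie.Build K semidirect
  semidirect_linearl semidirect_linearr semidirect_liexx semidirect_jacobi.

End Semidirect.

Definition completable (K : fieldType) (L : lieAlgType K) : Prop :=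
  exists2 t : torus L, maximal_torus t & complete (semidirect t).

Section MultiplicationTable.
Variables (K : fieldType) (n : nat).

(* The basis vectors are numbered from 1; basis_vec i = 0 unless 1 <= i <= n. *)
Definition basis_vec (i : nat) : 'rV[K]_n := \row_(j < n) (j.+1 == i)%:R.

Local Notation Y := basis_vec.

Variable T : nat -> nat -> 'rV[K]_n.

(* T i j is the value of [Y_i, Y_j] for i < j, and its values for i >= j are
   ignored: the other brackets follow by antisymmetry. *)
Definition table_bracket (i j : nat) : 'rV[K]_n :=
  (if (i < j)%N then T i j else 0) - (if (j < i)%N then T j i else 0).

Definition table_lie (x y : 'rV[K]_n) : 'rV[K]_n :=
  \sum_(i < n) \sum_(j < n) (x 0 i * y 0 j) *: table_bracket i.+1 j.+1.

Definition table_jacobi : Prop := forall i j l : nat,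
  table_lie (Y i) (table_lie (Y j) (Y l)) +
  table_lie (Y j) (table_lie (Y l) (Y i)) +
  table_lie (Y l) (table_lie (Y i) (Y j)) = 0.

Fact table_linearl y : linear (table_lie ^~ y).
Proof.
move=> a x1 x2; rewrite /table_lie scaler_sumr -big_split /=.
apply: eq_bigr => i _; rewrite scaler_sumr -big_split /=.
by apply: eq_bigr => j _; rewrite !mxE mulrDl scalerDl -mulrA scalerA.
Qed.

Fact table_linearr x : linear (table_lie x).
Proof.
move=> a y1 y2; rewrite /table_lie scaler_sumr -big_split /=.
apply: eq_bigr => i _; rewrite scaler_sumr -big_split /=.
by apply: eq_bigr => j _; rewrite !mxE mulrDr scalerDl mulrCA scalerA.
Qed.

Fact table_liexx x : table_lie x x = 0.
Proof.
rewrite /table_lie /table_bracket.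
under eq_bigr => i _ do [under eq_bigr => j _ do rewrite scalerBr; rewrite sumrB].
rewrite sumrB exchange_big /=; apply/eqP; rewrite subr_eq0; apply/eqP.
by apply: eq_bigr => i _; apply: eq_bigr => j _; rewrite mulrC.
Qed.

Lemma row_sum_basis (x : 'rV[K]_n) : x = \sum_(i < n) x 0 i *: Y i.+1.
Proof.
apply/rowP => j; rewrite summxE (bigD1 j) //= big1 ?addr0 => [|i ij].
  by rewrite !mxE eqxx mulr1.
by rewrite !mxE eqSS eq_sym (inj_eq val_inj) (negPf ij) mulr0.
Qed.

HB.instance Definition _ x :=
  GRing.isLinear.Build K 'rV[K]_n 'rV[K]_n _ (table_lie x) (table_linearr x).

Fact table_lie_jacobi : table_jacobi -> forall x y z,
  table_lie x (table_lie y z) + table_lie y (table_lie z x)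
  + table_lie z (table_lie x y) = 0.
Proof.
move=> jac.
pose J x y z := table_lie x (table_lie y z) + table_lie y (table_lie z x)
  + table_lie z (table_lie x y).
have Jrot x y z : J x y z = J y z x by rewrite /J -[LHS]addrA [LHS]addrC.
have Jlin a x1 x2 y z : J (a *: x1 + x2) y z = a *: J x1 y z + J x2 y z.
  rewrite /J !(table_linearl, linearP) /= !scalerDr.
  by rewrite (addrACA (a *: _)) [LHS]addrACA.
have J0 y z : J 0 y z = 0.
  by have := Jlin (-1) 0 0 y z; rewrite scaler0 addr0 scaleN1r addNr.
have Jred y z : (forall i, J (Y i) y z = 0) -> forall x, J x y z = 0.
  move=> H x; rewrite (row_sum_basis x).
  apply: (big_rec (fun u => J u y z = 0)) => // i u _ IH.
  by rewrite Jlin H IH scaler0 addr0.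
move=> x y z; rewrite -/(J x y z).
apply: (Jred) => i; rewrite Jrot; apply: (Jred) => j; rewrite Jrot.
by apply: (Jred) => l; apply: jac.
Qed.

Definition table_alg of table_jacobi : Type := 'rV[K]_n.

Variable jac : table_jacobi.

HB.instance Definition _ := Vector.on (table_alg jac).
HB.instance Definition _ := Vector_isLie.Build K (table_alg jac)
  table_linearl table_linearr table_liexx (table_lie_jacobi jac).

End MultiplicationTable.

Section TableTheory.
Variables (K : fieldType) (n : nat) (T : nat -> nat -> 'rV[K]_n).
Local Notation Y := (@basis_vec K n).

Lemma basis_vec_out i : (n < i)%N -> Y i = 0.
Proof. by move=> ni; apply/rowP => j; rewrite !mxE; case: eqP => // ij; have := ltn_ord j; lia. Qed.

Lemma basis_vec0 : Y 0 = 0.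
Proof. by apply/rowP => j; rewrite !mxE. Qed.

Lemma table_lie0l x : table_lie T 0 x = 0.
Proof.
by rewrite /table_lie big1 // => i _; rewrite big1 // => j _; rewrite mxE mul0r scale0r.
Qed.

Lemma table_lieY i j : (0 < i <= n)%N -> (0 < j <= n)%N ->
  table_lie T (Y i) (Y j) = table_bracket T i j.
Proof.
move=> /andP[i0 ni] /andP[j0 nj].
have in_ : (i.-1 < n)%N by lia.
have jn : (j.-1 < n)%N by lia.
rewrite /table_lie (bigD1 (Ordinal in_)) //= [X in _ + X]big1 ?addr0; last first.
  move=> u /eqP/val_eqP /= ui; rewrite big1 // => v _; rewrite !mxE.
  by rewrite (_ : (u.+1 == i) = false) ?mul0r ?scale0r //; lia.
rewrite (bigD1 (Ordinal jn)) //= big1 ?addr0; last first.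
  move=> u /eqP/val_eqP /= ui; rewrite !mxE.
  by rewrite (_ : (u.+1 == j) = false) ?mulr0 ?scale0r //; lia.
by rewrite !mxE /= !prednK // !eqxx mulr1 scale1r.
Qed.

(* Jacobi for tables of the form [Y_i, Y_j] = e_ij Y_(i+j) + q_ij Y_n. *)
Lemma table_jacobi_graded (q : nat -> nat -> K) :
    (forall i j, (0 < i <= n)%N -> (0 < j <= n)%N ->
       table_bracket T i j =
         ((i == 1%N)%:R - (j == 1%N)%:R) *: Y (i + j) + q i j *: Y n) ->
    (forall i j, (0 < i)%N -> (n <= j)%N -> q i j = 0) ->
    (forall i j l, (0 < i)%N -> (0 < j)%N -> (0 < l)%N ->
      ((j == 1%N)%:R - (l == 1%N)%:R) * q i (j + l)%N +
      ((l == 1%N)%:R - (i == 1%N)%:R) * q j (l + i)%N +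
      ((i == 1%N)%:R - (j == 1%N)%:R) * q l (i + j)%N = 0) ->
  table_jacobi T.
Proof.
move=> TE q0 qJ.
have E i j : (0 < i <= n)%N -> (0 < j)%N -> table_lie T (Y i) (Y j) =
    if (j <= n)%N then
    ((i == 1%N)%:R - (j == 1%N)%:R) *: Y (i + j) + q i j *: Y n else 0.
  move=> iP j0; case: leqP => jn; first by rewrite table_lieY ?TE ?j0.
  by rewrite (basis_vec_out jn) linear0.
have E2 i j l : (0 < i <= n)%N -> (0 < j <= n)%N -> (0 < l <= n)%N ->
    table_lie T (Y i) (table_lie T (Y j) (Y l)) =
    ((j == 1%N)%:R - (l == 1%N)%:R) *:
      ((i == 1%N)%:R *: Y (i + j + l) + q i (j + l)%N *: Y n).
  move=> iP jP lP; rewrite [X in table_lie T _ X]E ?ifT; try lia.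
  rewrite linearD !linearZ /= !E; try lia.
  rewrite leqnn (basis_vec_out (i := i + n)); last by lia.
  rewrite (q0 i n) ?scaler0 ?scale0r ?addr0 ?scaler0 ?addr0; try lia.
  rewrite addnA (_ : (j + l == 1)%N = false) ?subr0; last by lia.
  case: leqP => jln //; rewrite basis_vec_out; last by lia.
  by rewrite (q0 i (j + l)%N) ?scaler0 ?scale0r ?addr0 ?scaler0 //; lia.
have Y0 i : ~~ (0 < i <= n)%N -> Y i = 0.
  by case: i => [_|i iP]; [exact: basis_vec0|apply: basis_vec_out; lia].
move=> i j l.
have [iP|/Y0->] := boolP (0 < i <= n)%N; last by rewrite !(table_lie0l, linear0) !addr0.
have [jP|/Y0->] := boolP (0 < j <= n)%N; last by rewrite !(table_lie0l, linear0) !addr0.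
have [lP|/Y0->] := boolP (0 < l <= n)%N; last by rewrite !(table_lie0l, linear0) !addr0.
rewrite !E2 //.
have -> : (j + l + i = i + j + l)%N by lia.
have -> : (l + i + j = i + j + l)%N by lia.
have [/andP[i0 _] /andP[j0 _] /andP[l0 _]] := And3 iP jP lP.
rewrite !scalerDr !scalerA [X in X + _]addrACA -!scalerDl addrACA -!scalerDl qJ //.
by rewrite scale0r addr0 [X in X *: _](_ : _ = 0) ?scale0r //; ring.
Qed.

End TableTheory.

Section Families.
Variable K : fieldType.
Local Notation Y n := (@basis_vec K n).

Definition L_table (n i j : nat) : 'rV[K]_n :=
  if (i == 1%N) && (2 <= j <= n.-1)%N then Y n j.+1 else 0.

Lemma basis_bracketE n i j (Z := Y n (i + j)) :
    (0 < i <= n)%N -> (0 < j <= n)%N ->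
  (if [&& i < j, i == 1%N & 2 <= j <= n.-1]%N then Z else 0) -
  (if [&& j < i, j == 1%N & 2 <= i <= n.-1]%N then Z else 0) =
  ((i == 1%N)%:R - (j == 1%N)%:R) *: Z.
Proof.
move=> iP jP; have [nij|ijn] := ltnP n (i + j).
  by rewrite /Z basis_vec_out // scaler0 !if_same subr0.
have [i1|i1] := eqVneq i 1%N; have [j1|j1] := eqVneq j 1%N.
- by rewrite !ifF ?subrr ?scale0r //; lia.
- by rewrite ifT ?ifF ?subr0 ?scale1r //; lia.
- by rewrite ifF ?ifT ?sub0r ?scaleN1r //; lia.
- by rewrite !ifF ?subrr ?scale0r //; lia.
Qed.

Fact L_jacobi n : table_jacobi (L_table n).
Proof.
apply: (table_jacobi_graded (q := fun _ _ => 0)) => [i j iP jP|//|i j l _ _ _].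
  rewrite scale0r addr0 -basis_bracketE // /table_bracket /L_table.
  congr (_ - _).
    by case: (i < j)%N => //=; have [->|//] := eqVneq i 1%N; rewrite add1n.
  by case: (j < i)%N => //=; have [->|//] := eqVneq j 1%N; rewrite addn1.
by rewrite !mulr0 !addr0.
Qed.

Definition L_alg (n : nat) : lieAlgType K := table_alg (L_jacobi n).

Definition Q_table (p i j : nat) : 'rV[K]_p.*2 :=
  let n := p.*2 in
  if i == 1%N then (if (2 <= j <= n.-1)%N then Y n j.+1 else 0)
  else if (2 <= i <= p)%N && (i + j == n.+1)%N then (-1) ^+ i.+1 *: Y n n
  else 0.

Fact Q_jacobi p : table_jacobi (Q_table p).
Proof.
pose n := p.*2; have nE : n = p.*2 by [].
pose q i j : K := if [&& 1 < i, 1 < j & i + j == n.+1]%N then (-1) ^+ i.+1 else 0.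
have sgE i j : odd i = odd j -> (-1) ^+ i = (-1) ^+ j :> K.
  by move=> ij; rewrite -signr_odd ij signr_odd.
have sgN i j : odd i = ~~ odd j -> (-1) ^+ i = - (-1) ^+ j :> K.
  by move=> ij; rewrite -signr_odd ij -(signr_odd _ j); case: odd; rewrite ?expr0 ?expr1 ?opprK.
apply: (table_jacobi_graded (q := q)) => [i j iP jP|i j i0 nj|i j l i0 j0 l0].
- rewrite -basis_bracketE // /table_bracket /Q_table -/n /q.
  have [i1|i1] := eqVneq i 1%N; have [j1|j1] := eqVneq j 1%N.
  + by rewrite i1 j1 /= scale0r addr0.
  + have -> : (j < i)%N = false by lia.
    by rewrite i1 /= scale0r addr0 add1n; case: (1 < j)%N.
  + have -> : (i < j)%N = false by lia.
    by rewrite j1 /= andbF scale0r addr0 addn1; case: (1 < i)%N.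
  + have [ijn|ijn] := eqVneq (i + j)%N n.+1; last first.
      by rewrite (addnC j i) (negPf ijn) !andbF !if_same scale0r subr0 addr0.
    rewrite (addnC j i) ijn eqxx !andbT !andbF subr0 add0r [X in _ = X *: _]ifT; last by lia.
    have [ij|ji] := ltnP i j.
      by rewrite ifT ?ifF ?subr0 //; lia.
    rewrite ifT; last by lia.
    rewrite ifT; last by lia.
    rewrite sub0r -scaleNr; congr (_ *: _); rewrite (sgN i.+1 j.+1) //=.
    by rewrite negbK; have := congr1 odd ijn; rewrite oddD /= odd_double; case: odd; case: odd.
- by rewrite /q ifF //; lia.
- have [sn|sn] := eqVneq (i + j + l)%N n.+1; last first.
    by rewrite /q !ifF ?mulr0 ?addr0 //; lia.
  have qE u v : (1 < v)%N -> (u + v = n.+1)%N ->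
      q u v = if (1 < u)%N then (-1) ^+ u.+1 else 0.
    by move=> v1 uv; rewrite /q v1 uv eqxx /= !andbT.
  rewrite !qE; try lia.
  have gt1 u : (0 < u)%N -> (1 < u)%N = (u != 1%N) by case: u => [|[]].
  rewrite !gt1 //.
  have [i1|i1] := eqVneq i 1%N; have [j1|j1] := eqVneq j 1%N;
    have [l1|l1] := eqVneq l 1%N => /=; try by ring.
  + by rewrite (sgE l.+1 j.+1); [ring | lia].
  + by rewrite (sgE l.+1 i.+1); [ring | lia].
  + by rewrite (sgE j.+1 i.+1); [ring | lia].
Qed.

Definition Q_alg (p : nat) : lieAlgType K := table_alg (Q_jacobi p).

(* The conditions relating lam = (lambda_1, ..., lambda_(t-1)), with lambda_i
   stored as lam`_(i-1), to the constants a i j, which occur for i, j >= 2 and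
   i + j + k - 2 <= N.  On this range lam determines a. *)
Record compatible (N k t : nat) (lam : seq K) (a : nat -> nat -> K) : Prop :=
  Compatible {
  compatible_anti : forall i j, a i j = - a j i;
  compatible_add : forall i j, (2 <= i)%N -> (2 <= j)%N ->
    (i + j.+1 + k - 2 <= N)%N -> a i j = a i j.+1 + a i.+1 j;
  compatible_diag : forall i, (2 <= i <= t)%N -> a i i.+1 = lam`_(i - 2)
}.

Definition A_t (n k : nat) : nat := (n - k + 1)./2.

Definition A_table (n k : nat) (lam : seq K) (a : nat -> nat -> K) (i j : nat)
    : 'rV[K]_n :=
  if i == 1%N then (if (2 <= j <= n.-1)%N then Y n j.+1 else 0)
  else if j == i.+1 then
    (if (2 <= i <= A_t n k)%N then lam`_(i - 2) *: Y n (2 * i + k - 1) else 0)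
  else if (2 <= i)%N && (i + j + k - 2 <= n)%N then
    a i j *: Y n (i + j + k - 2)
  else 0.

Record A_admissible (n k : nat) (lam : (A_t n k).-1.-tuple K)
    (a : nat -> nat -> K) : Prop := AAdmissible {
  A_bounds : (2 <= k)%N && (k + 3 <= n)%N;
  A_nonzero : has (predC1 0) lam;
  A_compatible : compatible n k (A_t n k) lam a;
  A_jacobi : table_jacobi (A_table n k lam a)
}.

Definition A_alg n k (lam : (A_t n k).-1.-tuple K) a
    (adm : A_admissible lam a) : lieAlgType K :=
  table_alg (A_jacobi adm).

Definition B_t (n k : nat) : nat := (n - k)./2.

Definition B_table (n k : nat) (lam : seq K) (a : nat -> nat -> K) (i j : nat)
    : 'rV[K]_n :=
  if i == 1%N then (if (2 <= j <= n - 2)%N then Y n j.+1 else 0)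
  else if (2 <= i <= n.-1)%N && (i + j == n.+1)%N then (-1) ^+ i.+1 *: Y n n
  else if j == i.+1 then
    (if (2 <= i <= B_t n k)%N then lam`_(i - 2) *: Y n (2 * i + k - 1) else 0)
  else if [&& 2 <= i <= n - 2, 2 <= j <= n - 2 & i + j + k - 2 <= n.-1]%N then
    a i j *: Y n (i + j + k - 2)
  else 0.

Record B_admissible (n k : nat) (lam : (B_t n k).-1.-tuple K)
    (a : nat -> nat -> K) : Prop := BAdmissible {
  B_even : ~~ odd n;
  B_bounds : (2 <= k)%N && (k + 3 <= n)%N;
  B_nonzero : has (predC1 0) lam;
  B_compatible : compatible n.-1 k (B_t n k) lam a;
  B_jacobi : table_jacobi (B_table n k lam a)
}.

Definition B_alg n k (lam : (B_t n k).-1.-tuple K) a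
    (adm : B_admissible lam a) : lieAlgType K :=
  table_alg (B_jacobi adm).

End Families.

Arguments L_alg K n : clear implicits.
Arguments Q_alg K p : clear implicits.
Arguments A_admissible {K n k} lam a.
Arguments B_admissible {K n k} lam a.

(* Main.v *)
From HB Require Import structures.
Require Import Defs.
From mathcomp Require Import all_boot all_order all_algebra reals complex.
From mathcomp Require Import zify ring.
From Stdlib Require Import Classical.

Set Implicit Arguments.
Unset Strict Implicit.
Unset Printing Implicit Defensive.

Import Order.TTheory GRing.Theory Num.Theory.
Local Open Scope ring_scope.

(** A derivation with pairwise distinct nonzero eigenvalues has as centralizer in
    Der(n) a maximal torus t with n + t complete.  Each listed algebra carries such
    a derivation, in a basis for which the nonzero brackets are graded (for Q_n after
    replacing Y_1 by Y_1 + Y_2).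

    Conversely, a filiform algebra has a basis X_1, ..., X_n with [X_1, X_i] = X_(i+1)
    whose flags F_i = <X_i, ..., X_n> form the lower central series, and by Vergne's
    argument [F_i, F_j] lies in F_(i+j) for i, j >= 2, except that the brackets
    [X_i, X_(n+1-i)] may have a component (-1)^i delta X_n.  Take a nonzero element D
    of the torus and eigenvectors Y_1, Y_2 of weights alpha and beta outside the
    appropriate invariant subspaces, and let ad Y_1 generate the rest of the basis
    (when delta <> 0, the last basis vector is - [Y_2, Y_(n-1)]).
    If delta = 0, comparing weights gives L_n or A_n^k with beta = k alpha.
    If delta <> 0 and alpha <> 0, it gives Q_n or B_n^k.  If delta <> 0 and all
    the weights alpha vanish, then (ad Y_1)^3 is a derivation commuting with the torus
    whose extension to n + t is not inner, so n + t is not complete. *)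

(** * Brackets, frames and flags *)

(** For n >= 5 two hyperplanes are invariant under every derivation: F_2, which consists of the x
    with [x, F_3] inside F_5, and the centralizer of F_(n-1), with equation x_1 + delta x_2 = 0.
    They coincide exactly when delta = 0, whence the two cases of the converse. If delta <> 0, then
    Y_1 is an eigenvector in this centralizer and outside F_2, so that [Y_1, Y_(n-1)] = 0: the chain
    of Y_1 stops one step early, and the last basis vector has to come from the pairing of Y_2 with
    Y_(n-1). The defining basis of Q_n has its Y_1 outside the centralizer, hence a change of Y_1 in
    both directions of the proof.

    The cube of ad Y_1 arises as follows. When all alpha vanish, the weights are 0, beta and 2 beta,
    which forces [F_2, F_2] into F_n. Then ad Y_1 is skew for the bracket on F_2, and its odd powers
    are derivations. The first power is inner; the third is the next one available. *)

Section LieBasics.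
Variables (K : fieldType) (L : lieAlgType K).
Implicit Types (x y z : L) (a : K).

Lemma lieDl x y z : ⁅x + y, z⁆ = ⁅x, z⁆ + ⁅y, z⁆.
Proof. by have := lie_linearl z 1 x y; rewrite !scale1r. Qed.

Lemma lieDr x y z : ⁅x, y + z⁆ = ⁅x, y⁆ + ⁅x, z⁆.
Proof. exact: linearD. Qed.

Lemma lie0l x : ⁅0, x⁆ = 0 :> L.
Proof. by apply: (addrI ⁅0, x⁆); rewrite -lieDl !addr0. Qed.

Lemma lie0r x : ⁅x, 0⁆ = 0 :> L.
Proof. exact: linear0. Qed.

Lemma lieZl a x y : ⁅a *: x, y⁆ = a *: ⁅x, y⁆.
Proof. by have := lie_linearl y a x 0; rewrite !addr0 lie0l addr0. Qed.

Lemma lieZr a x y : ⁅x, a *: y⁆ = a *: ⁅x, y⁆.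
Proof. exact: linearZ. Qed.

Lemma lieNl x y : ⁅- x, y⁆ = - ⁅x, y⁆.
Proof. by rewrite -scaleN1r lieZl scaleN1r. Qed.

Lemma lieNr x y : ⁅x, - y⁆ = - ⁅x, y⁆.
Proof. exact: linearN. Qed.

Lemma lieBl x y z : ⁅x - y, z⁆ = ⁅x, z⁆ - ⁅y, z⁆.
Proof. by rewrite lieDl lieNl. Qed.

Lemma lieBr x y z : ⁅x, y - z⁆ = ⁅x, y⁆ - ⁅x, z⁆.
Proof. exact: linearB. Qed.

Lemma lie_suml n (f : 'I_n -> L) y : ⁅\sum_i f i, y⁆ = \sum_i ⁅f i, y⁆.
Proof.
exact: (big_morph (fun x => ⁅x, y⁆) (fun u v => lieDl u v y) (lie0l y)).
Qed.

Lemma lie_sumr n (f : 'I_n -> L) x : ⁅x, \sum_i f i⁆ = \sum_i ⁅x, f i⁆.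
Proof. exact: linear_sum. Qed.

Lemma lie_leibniz x y z : ⁅x, ⁅y, z⁆⁆ = ⁅⁅x, y⁆, z⁆ + ⁅y, ⁅x, z⁆⁆.
Proof.
have := lie_jacobi x y z; rewrite (lieC z ⁅x, y⁆) (lieC z x) lieNr.
by move/eqP; rewrite subr_eq0 => /eqP <-; rewrite addrAC -addrA subrr addr0.
Qed.

End LieBasics.

(* Families are numbered from 1 and vanish outside [1, n]. *)
Definition frame (K : fieldType) (L : vectType K) n (e : nat -> L) :=
  basis_of fullv [tuple e j.+1 | j < n] /\ forall i, ~~ (0 < i <= n)%N -> e i = 0.

(** The sum has at most one term; written this way the coordinate is total in [i], with value 0
    outside [1, n]. *)
Definition co (K : fieldType) (L : vectType K) n (e : nat -> L) i x : K :=
  \sum_(j < n | j.+1 == i) coord [tuple e j.+1 | j < n] j x.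

Definition comb (K : fieldType) (L : vectType K) n (e : nat -> L) (v : 'rV[K]_n) : L :=
  \sum_(j < n) v 0 j *: e j.+1.

Definition flag (K : fieldType) (L : vectType K) n (e : nat -> L) m x : Prop :=
  forall i, (i < m)%N -> co n e i x = 0.

Section Frames.
Variables (K : fieldType) (L : vectType K) (n : nat) (e : nat -> L).
Hypothesis he : frame n e.
Implicit Types (x y z : L) (a : K).

Local Notation co := (co n e).
Local Notation flag := (flag n e).

Lemma frame_out i : ~~ (0 < i <= n)%N -> e i = 0.
Proof. by case: he => _; apply. Qed.

Lemma co_out i x : ~~ (0 < i <= n)%N -> co i x = 0.
Proof.
move=> iP; rewrite /co big_pred0 // => j; apply/eqP => ji; have := ltn_ord j; lia.
Qed.

Lemma coP i a x y : co i (a *: x + y) = a * co i x + co i y.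
Proof.
rewrite /co mulr_sumr -big_split /=; apply: eq_bigr => j _.
by rewrite linearP.
Qed.

Lemma coD i x y : co i (x + y) = co i x + co i y.
Proof. by have := coP i 1 x y; rewrite scale1r mul1r. Qed.

Lemma co0 i : co i 0 = 0.
Proof. by apply: (addrI (co i 0)); rewrite -coD !addr0. Qed.

Lemma coZ i a x : co i (a *: x) = a * co i x.
Proof. by have := coP i a x 0; rewrite !addr0 co0 addr0. Qed.

Lemma coN i x : co i (- x) = - co i x.
Proof. by rewrite -scaleN1r coZ mulN1r. Qed.

Lemma coB i x y : co i (x - y) = co i x - co i y.
Proof. by rewrite coD coN. Qed.

Lemma co_sum i m (f : 'I_m -> L) : co i (\sum_j f j) = \sum_j co i (f j).
Proof. exact: (big_morph (co i) (coD i) (co0 i)). Qed.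

Lemma co_ord (j : 'I_n) x : co j.+1 x = coord [tuple e j.+1 | j < n] j x.
Proof.
rewrite /co (bigD1 j) //= big1 ?addr0 // => i /andP[/eqP[ij] /eqP nij].
by case: nij; apply: val_inj.
Qed.

Lemma comb_co x : x = \sum_(j < n) co j.+1 x *: e j.+1.
Proof.
case: he => /coord_basis/(_ (memvf x)) {1}-> _; apply: eq_bigr => j _.
by rewrite co_ord -tnth_nth tnth_mktuple.
Qed.

Lemma co_frame i j : (0 < i <= n)%N -> co i (e j) = (i == j)%:R.
Proof.
move=> iP; have [jP|jP] := boolP (0 < j <= n)%N; last first.
  rewrite frame_out // co0; case: eqP => // ij; move: jP; by rewrite -ij iP.
case: i iP => // i /= iP; case: j jP => // j /= jP.
rewrite (co_ord (Ordinal iP)) eqSS.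
have -> : e j.+1 = [tuple e k.+1 | k < n]`_(Ordinal jP).
  by rewrite -tnth_nth tnth_mktuple.
by case: he => /basis_free fr _; rewrite coord_free // -val_eqE /= eq_sym.
Qed.

Lemma co_frame_ne i j : i != j -> co i (e j) = 0.
Proof.
move=> ij; have [iP|/co_out->//] := boolP (0 < i <= n)%N.
by rewrite co_frame // (negPf ij).
Qed.

Lemma frame_dim : \dim {:L} = n.
Proof. by case: he => /size_basis ->. Qed.

Lemma co_inj x y : (forall i, (0 < i <= n)%N -> co i x = co i y) -> x = y.
Proof.
move=> H; rewrite (comb_co x) (comb_co y); apply: eq_bigr => j _; congr (_ *: _).
by apply: H; rewrite /= ltn_ord.
Qed.

Lemma frame_neq0 i : (0 < i <= n)%N -> e i != 0.
Proof.
move=> iP; apply/eqP => ei; have := co_frame i iP.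
by rewrite ei co0 eqxx => /eqP; rewrite eq_sym oner_eq0.
Qed.

Lemma frame_ind (P : L -> Prop) : P 0 -> (forall a x y, P x -> P y -> P (a *: x + y)) ->
  forall m, (forall i, (m <= i)%N -> (0 < i <= n)%N -> P (e i)) ->
  forall x, flag m x -> P x.
Proof.
move=> P0 PL m Pe x Fx; rewrite (comb_co x).
apply: (big_rec P) => // j y _ Py; have [mj|jm] := leqP m j.+1.
  by apply: PL => //; apply: Pe => //=; rewrite ltn_ord.
by rewrite Fx // scale0r add0r.
Qed.

Lemma frame_indT (P : L -> Prop) : P 0 -> (forall a x y, P x -> P y -> P (a *: x + y)) ->
  (forall i, (0 < i <= n)%N -> P (e i)) -> forall x, P x.
Proof.
move=> P0 PL Pe x; apply: (frame_ind P0 PL (m := 0)) => // i _; exact: Pe.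
Qed.

Lemma flag0 m : flag m 0.
Proof. by move=> i _; rewrite co0. Qed.

Lemma flagL m a x y : flag m x -> flag m y -> flag m (a *: x + y).
Proof. by move=> Fx Fy i im; rewrite coP Fx // Fy // mulr0 addr0. Qed.

Lemma flagD m x y : flag m x -> flag m y -> flag m (x + y).
Proof. by move=> Fx Fy i im; rewrite coD Fx // Fy // addr0. Qed.

Lemma flagZ m a x : flag m x -> flag m (a *: x).
Proof. by move=> Fx i im; rewrite coZ Fx // mulr0. Qed.

Lemma flagN m x : flag m x -> flag m (- x).
Proof. by move=> Fx i im; rewrite coN Fx // oppr0. Qed.

Lemma flagB m x y : flag m x -> flag m y -> flag m (x - y).
Proof. by move=> Fx /flagN; apply: flagD. Qed.

Lemma flag_frame m i : (m <= i)%N -> flag m (e i).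
Proof.
move=> mi j jm; have [jP|jP] := boolP (0 < j <= n)%N; last by rewrite co_out.
by rewrite co_frame //; case: eqP => // ?; lia.
Qed.

Lemma flag_le m m' x : (m <= m')%N -> flag m' x -> flag m x.
Proof. by move=> mm F i im; apply: F; lia. Qed.

Lemma flag1 x : flag 1 x.
Proof. by case=> // _; rewrite co_out. Qed.

Lemma flag_gt m x : (n < m)%N -> flag m x -> x = 0.
Proof. by move=> nm F; apply: co_inj => i iP; rewrite co0 F //; lia. Qed.

Lemma flagS m x : flag m x -> co m x = 0 -> flag m.+1 x.
Proof. by move=> F xm i; rewrite ltnS leq_eqVlt => /orP[/eqP->|/F]. Qed.

Lemma flag_tail m x : flag m x -> flag m.+1 (x - co m x *: e m).
Proof.
have [mP|mP] := boolP (0 < m <= n)%N; last first.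
  by rewrite co_out // scale0r subr0 => F; apply: flagS => //; rewrite co_out.
move=> F; apply: flagS; first by apply: flagB => //; apply: flagZ; apply: flag_frame.
by rewrite coB coZ co_frame // eqxx mulr1 subrr.
Qed.

Lemma combE (v : 'rV_n) i : (0 < i <= n)%N ->
  co i (comb e v) = \sum_(j < n | j.+1 == i) v 0 j.
Proof.
move=> iP; rewrite /comb co_sum [RHS]big_mkcond; apply: eq_bigr => j _.
by rewrite coZ co_frame // eq_sym; case: eqP => _; rewrite ?mulr1 ?mulr0.
Qed.

Lemma comb_linear : linear (comb e : 'rV[K]_n -> L).
Proof.
move=> a u v; rewrite /comb scaler_sumr -big_split /=; apply: eq_bigr => j _.
by rewrite !mxE scalerDl scalerA.
Qed.

Lemma comb_basis i : comb e (basis_vec K n i) = e i.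
Proof.
rewrite /comb; have [iP|iP] := boolP (0 < i <= n)%N; last first.
  rewrite frame_out // big1 // => j _; rewrite !mxE.
  case: eqP => [ji|]; rewrite ?scale0r //; have := ltn_ord j; lia.
case: i iP => // i /= iP; rewrite (bigD1 (Ordinal iP)) //= big1 => [|j].
  by rewrite mxE eqxx scale1r addr0.
by move=> /eqP ji; rewrite mxE eqSS; case: eqP => [?|_]; [case: ji; apply: val_inj|rewrite scale0r].
Qed.

Lemma comb_inj : injective (comb e : 'rV[K]_n -> L).
Proof.
move=> u v uv; apply/rowP => j.
have jP : (0 < j.+1 <= n)%N by rewrite /= ltn_ord.
have E w : co j.+1 (comb e w) = w 0 j.
  by rewrite combE // (bigD1 j) //= big1 ?addr0 // => i /andP[/eqP[ij] /eqP[]]; apply: val_inj.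
by rewrite -E uv E.
Qed.

End Frames.

Arguments comb {K L n} e v.

Lemma frame_of_free (K : fieldType) (L : vectType K) n (e : nat -> L) :
  \dim {:L} = n -> (forall i, ~~ (0 < i <= n)%N -> e i = 0) ->
  (forall a : nat -> K, \sum_(j < n) a j.+1 *: e j.+1 = 0 ->
     forall i, (0 < i <= n)%N -> a i = 0) ->
  frame n e.
Proof.
move=> dn eo fr; split=> //; rewrite basisEfree subvf size_tuple dn leqnn !andbT.
apply/freeP => k k0 i.
pose a j := if @insub _ _ 'I_n j.-1 is Some u then k u else 0.
have aE (j : 'I_n) : a j.+1 = k j.
  by rewrite /a /= insubT // => jP; congr (k _); apply: val_inj.
rewrite -aE; apply: fr; last by rewrite /= ltn_ord.
rewrite -[RHS]k0; apply: eq_bigr => j _.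
by rewrite aE -tnth_nth tnth_mktuple.
Qed.

Section Triangular.
Variables (K : fieldType) (L : vectType K) (n : nat) (e e' : nat -> L).
Hypothesis he : frame n e.
Hypothesis e'o : forall i, ~~ (0 < i <= n)%N -> e' i = 0.
Hypothesis e'F : forall i, (0 < i <= n)%N -> flag n e i (e' i).
Hypothesis e'n : forall i, (0 < i <= n)%N -> co n e i (e' i) != 0.

(** Coordinate i of a vanishing combination involves only coefficients of index at most i, so these
    vanish one after the other. *)
Lemma frame_triangular : frame n e'.
Proof.
apply: frame_of_free e'o _; first exact: frame_dim he.
move=> a a0; elim/ltn_ind => i IH iP.
have := congr1 (co n e i) a0; rewrite co0 co_sum.
case: i IH iP => // i IH /= iP; rewrite (bigD1 (Ordinal iP)) //= big1 => [|j /eqP ji].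
  by rewrite addr0 coZ => /eqP; rewrite mulf_eq0 (negPf (e'n _)) // orbF => /eqP.
rewrite coZ; have {}ji : (j : nat) <> i by move=> H; case: ji; apply: val_inj.
have [ltji|ltij|] := ltngtP j i; last by [].
  by rewrite IH ?mul0r //= ltn_ord.
by rewrite e'F ?mulr0 //= ltn_ord.
Qed.

(** Downward induction on [m], with [k] bounding n + 1 - m: a multiple of [e' m] removes the leading
    coordinate and moves [x] into the next flag. *)
Lemma flag_triangular_inv m x : flag n e m x -> flag n e' m x.
Proof.
suff H k : (forall m x, (n < m + k)%N -> flag n e m x -> flag n e' m x).
  by move=> Fx; apply: (H n.+1) Fx; lia.
elim: k => [|k IH] {}m {}x mk Fx.
  by rewrite (flag_gt he _ Fx); [apply: flag0 | rewrite addn0 in mk].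
have [mP|mP] := boolP (0 < m <= n)%N; last first.
  case: m mk Fx mP => [|m] mk Fx mP; first by [].
  by rewrite (flag_gt he _ Fx); [apply: flag0|lia].
pose a := co n e m x / co n e m (e' m).
have Ft : flag n e m.+1 (x - a *: e' m).
  apply: flagS; first by apply: flagB => //; apply: flagZ; apply: e'F.
  by rewrite coB coZ /a divfK ?subrr // e'n.
have := IH _ _ _ Ft; rewrite addSn => /(_ ltac:(lia)) F'.
rewrite -(subrK (a *: e' m) x); apply: flagD; first exact: flag_le F'.
by apply: flagZ; apply: (flag_frame frame_triangular).
Qed.

End Triangular.

(** * Presentation by a multiplication table *)

Definition presents (K : fieldType) (L : lieAlgType K) n
    (T : nat -> nat -> 'rV[K]_n) (e : nat -> L) :=
  forall i j, (0 < i)%N -> (i < j)%N -> (j <= n)%N -> ⁅e i, e j⁆ = comb e (T i j).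

Section Presentation.
Variables (K : fieldType) (L : lieAlgType K) (n : nat) (T : nat -> nat -> 'rV[K]_n).

Lemma presents_comb (e : nat -> L) : presents T e ->
  forall u v, comb e (table_lie T u v) = ⁅comb e u, comb e v⁆.
Proof.
move=> pe; have cL := @comb_linear K L n e.
have c0 : comb e (0 : 'rV[K]_n) = 0 by rewrite /comb big1 // => j _; rewrite mxE scale0r.
have cD (u v : 'rV[K]_n) : comb e (u + v) = comb e u + comb e v.
  by have := cL 1 u v; rewrite !scale1r.
have cZ a (u : 'rV[K]_n) : comb e (a *: u) = a *: comb e u by have := cL a u 0; rewrite c0 !addr0.
have cN (u : 'rV[K]_n) : comb e (- u) = - comb e u by rewrite -scaleN1r cZ scaleN1r.
have bE i j : (0 < i <= n)%N -> (0 < j <= n)%N ->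
    comb e (table_bracket T i j) = ⁅e i, e j⁆.
  move=> iP jP; rewrite /table_bracket cD cN; have [ij|ji|->] := ltngtP i j.
  - by rewrite c0 subr0 pe //; lia.
  - by rewrite c0 sub0r [RHS]lieC pe //; lia.
  - by rewrite c0 subrr liexx.
move=> u v; rewrite /table_lie (big_morph _ cD c0) lie_suml.
apply: eq_bigr => i _; rewrite (big_morph _ cD c0) lie_sumr.
apply: eq_bigr => j _; rewrite cZ bE /= ?ltn_ord //.
by rewrite lieZl lieZr scalerA.
Qed.

(** The Jacobi identity of [L] is pulled back along the injective [comb e]; this is how tables read
    off from a given algebra become admissible. *)
Lemma presents_jacobi (e : nat -> L) : frame n e -> presents T e -> table_jacobi T.
Proof.
move=> he pe i j l; apply: (comb_inj he).
have cL := @comb_linear K L n e.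
have c0 : comb e (0 : 'rV[K]_n) = 0 by rewrite /comb big1 // => s _; rewrite mxE scale0r.
have cD (u v : 'rV[K]_n) : comb e (u + v) = comb e u + comb e v.
  by have := cL 1 u v; rewrite !scale1r.
by rewrite !cD !presents_comb // !comb_basis // lie_jacobi c0.
Qed.

Lemma presents_iso (e : nat -> L) (jac : table_jacobi T) :
  frame n e -> presents T e -> L ≅ table_alg jac.
Proof.
move=> he pe; pose f (x : L) : 'rV[K]_n := \row_j co n e j.+1 x.
have fL : linear f by move=> a x y; apply/rowP => j; rewrite !mxE coP.
have fK : cancel f (comb e : 'rV_n -> L).
  move=> x; rewrite [RHS](comb_co he) /comb.
  by apply: eq_bigr => j _; rewrite mxE.
have cK : cancel (comb e : 'rV_n -> L) f.
  by move=> v; apply: (comb_inj he); rewrite fK.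
pose fl := GRing.isLinear.Build K L (table_alg jac) *:%R f fL.
pose F : {linear L -> table_alg jac} := HB.pack f fl.
exists F; first by exists (comb e : 'rV_n -> L).
move=> x y; apply: (can_inj cK); rewrite /= fK.
by rewrite presents_comb // !fK.
Qed.

Lemma frame_of_iso (jac : table_jacobi T) : L ≅ table_alg jac ->
  exists2 e : nat -> L, frame n e & presents T e.
Proof.
case=> f [h hK fK] fM.
have hL : linear (h : 'rV[K]_n -> L).
  move=> a x y; apply: (can_inj hK); rewrite fK.
  by rewrite (linearP f) !fK.
pose hl := GRing.isLinear.Build K 'rV[K]_n L *:%R h hL.
pose H : {linear 'rV[K]_n -> L} := HB.pack (h : 'rV[K]_n -> L) hl.
have HhE v : H v = h v by [].
pose e i := H (basis_vec K n i).
have HE v : H v = comb e v.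
  by rewrite {1}(row_sum_basis v) linear_sum; apply: eq_bigr => j _; rewrite linearZ.
have eo i : ~~ (0 < i <= n)%N -> e i = 0.
  move=> iP; rewrite /e; have -> : basis_vec K n i = 0; last exact: linear0.
  by case: i iP => [|i] iP; [apply: basis_vec0 | apply: basis_vec_out; lia].
exists e.
  apply: frame_of_free eo _.
    pose fv : 'Hom(L, 'rV[K]_n) := linfun (f : L -> 'rV[K]_n).
    have fvE x : fv x = f x by rewrite lfunE.
    have k0 : lker fv == 0%VS.
      by apply/lker0P => x y; rewrite !fvE; apply: can_inj hK _ _.
    have <- : \dim (fv @: {:L}) = \dim {:L}.
      by apply: limg_dim_eq; rewrite (eqP k0) capv0.
    have -> : (fv @: {:L})%VS = fullv.
      apply/eqP; rewrite eqEsubv subvf; apply/subvP => v _.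
      by rewrite -(fK v) -[f _]fvE memv_img // memvf.
    by rewrite dimvf /dim /= mul1n.
  move=> a a0 i iP; case: i iP => // i /= iP.
  have : H (\row_j a j.+1) = 0.
    by rewrite HE /comb -[RHS]a0; apply: eq_bigr => j _; rewrite mxE.
  move/(congr1 f); rewrite HhE fK linear0 => /rowP/(_ (Ordinal iP)).
  by rewrite !mxE.
move=> i j i0 ij jn; apply: (can_inj hK).
rewrite fM !fK -HE HhE fK /lie /= table_lieY; try lia.
by rewrite /table_bracket ij ifF ?subr0 //; lia.
Qed.

End Presentation.

(** * Completability from a derivation with simple spectrum *)

(** As long as a vector satisfying [P] is missing it is adjoined, and the dimension stops the
    process. This turns the centralizer of a derivation into a [{vspace}]. *)
Lemma vspace_of_closed (K : fieldType) (V : vectType K) (P : V -> Prop) :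
  P 0 -> (forall a x y, P x -> P y -> P (a *: x + y)) ->
  exists U : {vspace V}, forall x, x \in U <-> P x.
Proof.
move=> P0 PL.
suff H k : exists2 U : {vspace V}, forall x, x \in U -> P x &
    (k <= \dim U)%N \/ forall x, P x -> x \in U.
  have [U UP [kU|PU]] := H (\dim {:V}).+1; last by exists U => x; split; auto.
  by have := dimvS (subvf U); rewrite leqNgt kU.
elim: k => [|k [U UP [kU|PU]]]; first by exists 0%VS; [move=> x /vlineP[a ->]; rewrite scaler0|left].
  have [[x [Px xU]]|nx] := classic (exists x, P x /\ x \notin U).
    exists (U + <[x]>)%VS.
      move=> _ /memv_addP[u uU [_ /vlineP[a ->] ->]].
      by rewrite addrC; apply: PL => //; apply: UP.
    left; apply: leq_ltn_trans kU _; rewrite ltn_neqAle dimvS ?addvSl // andbT.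
    apply/negP => dU; have : x \in (U + <[x]>)%VS.
      by rewrite -{1}[x]add0r; apply: memv_add; [apply: mem0v|apply: memv_line].
    by have /eqP <- : U == (U + <[x]>)%VS by [rewrite eqEdim addvSl /= (eqP dU)]; apply/negP.
  exists U => //; right=> x Px; apply/negPn/negP => xU; apply: nx; by exists x.
by exists U; auto.
Qed.

Section SimpleSpectrum.
Variables (K : fieldType) (L : lieAlgType K) (n : nat) (e : nat -> L) (w : nat -> K).
Hypothesis he : frame n e.
Hypothesis w0 : forall i, (0 < i <= n)%N -> w i != 0.
Hypothesis w_inj : forall i j, (0 < i <= n)%N -> (0 < j <= n)%N -> w i = w j -> i = j.
Hypothesis w_grade : forall i j l, (0 < i)%N -> (i < j)%N -> (j <= n)%N ->
  co n e l ⁅e i, e j⁆ <> 0 -> w l = w i + w j.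

Let D0 (x : L) : L := \sum_(j < n) (w j.+1 * co n e j.+1 x) *: e j.+1.

Let D0_linear : linear D0.
Proof.
move=> a x y; rewrite /D0 scaler_sumr -big_split /=; apply: eq_bigr => j _.
by rewrite coP mulrDr scalerDl scalerA mulrCA.
Qed.

HB.instance Definition _ := GRing.isLinear.Build K L L *:%R D0 D0_linear.

Let D : 'End(L) := linfun D0.

Let coD0 i x : co n e i (D x) = w i * co n e i x.
Proof.
have [iP|iP] := boolP (0 < i <= n)%N; last by rewrite !co_out // mulr0.
rewrite lfunE /= /D0 co_sum; case: i iP => // i /= iP.
rewrite (bigD1 (Ordinal iP)) //= big1 ?addr0 => [|j /eqP ji].
  by rewrite coZ co_frame // eqxx mulr1.
rewrite coZ co_frame // eqSS; case: eqP => [ij|_]; last by rewrite mulr0.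
by case: ji; apply: val_inj.
Qed.

Let De i : D (e i) = w i *: e i.
Proof.
apply: (co_inj he) => j jP; rewrite coD0 coZ co_frame //.
by case: eqP => [->|]; rewrite ?mulr0.
Qed.

Lemma derivation_frame (f : 'End(L)) :
  (forall i j, (0 < i)%N -> (i < j)%N -> (j <= n)%N ->
     f ⁅e i, e j⁆ = ⁅f (e i), e j⁆ + ⁅e i, f (e j)⁆) -> derivation f.
Proof.
move=> fe.
have fe' i j : f ⁅e i, e j⁆ = ⁅f (e i), e j⁆ + ⁅e i, f (e j)⁆.
  have [iP|iP] := boolP (0 < i <= n)%N; last first.
    by rewrite (frame_out he iP) !(lie0l, linear0) addr0.
  have [jP|jP] := boolP (0 < j <= n)%N; last first.
    by rewrite (frame_out he jP) !(lie0r, lie0l, linear0) addr0.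
  have [ij|ji|->] := ltngtP i j.
  - by apply: fe => //; lia.
  - rewrite lieC linearN /= fe; try lia.
    by rewrite opprD addrC (lieC (f (e i))) (lieC (e i)).
  - by rewrite liexx linear0 (lieC (e j) (f (e j))) subrr.
move=> x y; elim/(frame_indT he): x.
- by rewrite !(lie0l, linear0) addr0.
- move=> a u v Hu Hv; rewrite !linearP /= !(lieDl, lieZl) linearP /= Hu Hv.
  by rewrite !scalerDr addrACA.
move=> i _; elim/(frame_indT he): y => //.
- by rewrite !(lie0r, lie0l, linear0) addr0.
- move=> a u v Hu Hv; rewrite !linearP /= Hu Hv.
  by rewrite !scalerDr addrACA.
Qed.

Let D_der : derivation D.
Proof.
apply: derivation_frame => i j i0 ij jn; rewrite !De lieZl lieZr -scalerDl.
apply: (co_inj he) => l _; rewrite coD0 coZ.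
have [->|/eqP H] := eqVneq (co n e l ⁅e i, e j⁆) 0; first by rewrite !mulr0.
by rewrite (w_grade _ _ _ H).
Qed.

(** Coordinate j of [h (D (e i))] = [D (h (e i))] says that w_i - w_j annihilates coordinate j of
    [h (e i)]. *)
Let diag_commute (h : 'End(L)) : (h \o D = D \o h)%VF ->
  forall i, h (e i) = co n e i (h (e i)) *: e i.
Proof.
move=> hD i; have [iP|iP] := boolP (0 < i <= n)%N; last first.
  by rewrite (frame_out he iP) linear0 scaler0.
apply: (co_inj he) => j jP; rewrite coZ co_frame //.
have [->|ij] := eqVneq j i; first by rewrite mulr1.
rewrite mulr0; apply/eqP; have := congr1 (fun f : 'End(L) => co n e j (f (e i))) hD.
rewrite /= !comp_lfunE De linearZ /= coZ coD0 => /eqP.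
rewrite -subr_eq0 -mulrBl mulf_eq0 subr_eq0 => /orP[/eqP wij|//].
by rewrite (w_inj iP jP wij) eqxx in ij.
Qed.

(** The derivations commuting with D are diagonal in [e], so they form a torus; it is maximal
    because a torus containing D commutes with D. A derivation of the semidirect product is
    corrected by an inner one until it maps D into the torus; the distinct weights then make it
    diagonal on [L], hence the bracket with an element of the torus. *)
Lemma completable_simple_spectrum : completable L.
Proof.
have [t tP] : exists t : {vspace 'End(L)},
    forall h, h \in t <-> derivation h /\ (h \o D = D \o h)%VF.
  apply: vspace_of_closed => [|a f g [fd fc] [gd gc]].
  - split; last by rewrite comp_lfun0l comp_lfun0r.
    by move=> x y; rewrite !lfunE /= lie0l lie0r addr0.
  - split; last by rewrite comp_lfunDl comp_lfunDr -comp_lfunZl -comp_lfunZr fc gc.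
    by move=> x y; rewrite !lfunE /= !lfunE /= fd gd lieDl lieDr lieZl lieZr scalerDr addrACA.
have tdiag h i : h \in t -> h (e i) = co n e i (h (e i)) *: e i.
  by case/tP => _ /diag_commute.
have eq_frame (f g : 'End(L)) : (forall i, f (e i) = g (e i)) -> f = g.
  move=> fg; apply/lfunP => x; elim/(frame_indT he): x => //.
    by rewrite !linear0.
  by move=> a u v Hu Hv; rewrite !linearP /= Hu Hv.
have tt : is_torus t.
  split=> [h /tP[]//|h ht|h h' ht h't].
    exists [tuple e j.+1 | j < n]; first by case: he.
    by move=> v /tnthP[j ->]; rewrite tnth_mktuple; exists (co n e j.+1 (h (e j.+1))); apply: tdiag.
  apply: eq_frame => i; rewrite !comp_lfunE.
  move: (tdiag _ i ht) (tdiag _ i h't); move: (co n e i _) (co n e i _) => a b ha hb.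
  by rewrite ha hb !linearZ /= ha hb !scalerA mulrC.
have Dt : D \in t by apply/tP.
exists (Torus tt).
  move=> t' tt'; apply/subvP => h ht'; apply/tP; have [der _ com] := torusP t'.
  by split; [apply: der | apply: com => //; apply: (subvP tt')].
set s := semidirect _.
pose D1 : s := (0, Subvs Dt).
have sE (x y : s) : ⁅x, y⁆ = (⁅x.1, y.1⁆ + vsval x.2 y.1 - vsval y.2 x.1, 0) by [].
have sub0 (u : subvs_of t) : (forall i, vsval u (e i) = 0) -> u = 0.
  move=> ui; apply: val_inj; apply: eq_frame => i.
  by rewrite ui lfunE.
have D0' x : D x = 0 -> x = 0.
  move=> Dx; apply: (co_inj he) => i iP; apply: (mulfI (w0 iP)).
  by rewrite -coD0 Dx !co0 mulr0.
split.
  case=> x h xh0.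
  have x0 : x = 0.
    have := congr1 fst (xh0 D1); rewrite sE /= lie0r linear0 addr0 sub0r.
    by move/eqP; rewrite oppr_eq0 => /eqP/D0'.
  have h0 : h = 0.
    apply: sub0 => i; have := congr1 fst (xh0 (e i, 0)).
    by rewrite sE /= x0 lie0l add0r linear0 subr0.
  by rewrite x0 h0.
move=> Del Dd.
(* [y0] is the preimage under D of the [L]-component of [Del D1]. As [y0, D1] = - D y0, adding the
   bracket with [y0] leaves [A D1] in the torus. *)
pose y0 := \sum_(j < n) ((w j.+1)^-1 * co n e j.+1 (Del D1).1) *: e j.+1.
have Dy0 : D y0 = (Del D1).1.
  rewrite [RHS](comb_co he) /y0 linear_sum; apply: eq_bigr => j _.
  by rewrite linearZ /= De scalerA mulrAC mulVf ?mul1r // w0 /= ?ltn_ord.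
pose A (z : s) := Del z + ⁅(y0, 0) : s, z⁆.
have Ad x y : A ⁅x, y⁆ = ⁅A x, y⁆ + ⁅x, A y⁆.
  by rewrite /A Dd lie_leibniz lieDl lieDr addrACA.
have AZ a x : A (a *: x) = a *: A x by rewrite /A linearZ /= lieZr scalerDr.
have A0 : A 0 = 0 by rewrite /A linear0 lie0r addr0.
have AD x y : A (x + y) = A x + A y by rewrite /A linearD /= lieDr addrACA.
have AD1 : (A D1).1 = 0.
  by rewrite /A /= lie0r linear0 !add0r Dy0 subrr.
have DelE z : Del z = A z - ⁅(y0, 0) : s, z⁆ by rewrite /A addrK.
clearbody A.
(* [D1] commutes with (0, h). Applying [A] to this bracket leaves D of the component in question,
   and D is injective. *)
have Ah h : (A (0, h)).1 = 0.
  have := Ad D1 (0, h); rewrite [X in A X]sE /= !(lie0l, linear0, addr0).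
  rewrite -/(0 : s) A0 => /(congr1 fst); rewrite !sE /= AD1 !(lie0l, lie0r, linear0, add0r, subr0).
  by move=> H; apply: D0'.
(* [A] applied to [D1, e_i] = w_i e_i: the torus component is killed by w_i <> 0, and coordinate j
   <> i by w_i - w_j <> 0, since [A D1] acts diagonally. *)
have Ae i : A (e i, 0) = (co n e i (A (e i, 0)).1 *: e i, 0).
  have [iP|iP] := boolP (0 < i <= n)%N; last first.
    by rewrite (frame_out he iP) -/(0 : s) A0 scaler0.
  have := Ad D1 (e i, 0); rewrite [X in A X]sE /= !(lie0l, linear0, add0r, subr0) De.
  have -> : (w i *: e i, 0) = w i *: ((e i, 0) : s) by rewrite [RHS]surjective_pairing /= scaler0.
  rewrite AZ !sE /= AD1 !(lie0l, linear0, add0r, subr0).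
  have tA := tdiag (vsval (A D1).2) i (subvsP _).
  move=> H; have H2 := congr1 snd H; have {H}H1 := congr1 fst H.
  move: H2 H1; rewrite /= addr0 => /eqP; rewrite scaler_eq0 (negPf (w0 iP)) /= => /eqP A2 H1.
  rewrite [LHS]surjective_pairing A2; congr pair; apply: (co_inj he) => j jP.
  rewrite coZ co_frame //; have [->|ij] := eqVneq j i; first by rewrite mulr1.
  have /eqP := congr1 (co n e j) H1; rewrite coZ coD coD0 tA coZ co_frame // (negPf ij).
  rewrite mulr0 add0r -subr_eq0 -mulrBl mulf_eq0 subr_eq0 mulr0 => /orP[/eqP|/eqP//].
  by move/(w_inj iP jP) => ij'; rewrite ij' eqxx in ij.
pose d (x : L) := (A (x, 0)).1.
have dL : linear d.
  move=> a x y; rewrite /d.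
  have -> : (a *: x + y, 0) = a *: ((x, 0) : s) + (y, 0) by rewrite [RHS]surjective_pairing /= scaler0 addr0.
  by rewrite AD AZ.
pose dl := GRing.isLinear.Build K L L *:%R d dL.
pose dH : {linear L -> L} := HB.pack d dl.
have AE x : A (x, 0) = (d x, 0).
  elim/(frame_indT he): x.
  - by rewrite /d -/(0 : s) A0.
  - move=> a u v Hu Hv; rewrite [LHS]surjective_pairing; congr pair.
    have -> : (a *: u + v, 0) = a *: ((u, 0) : s) + (v, 0) by rewrite [RHS]surjective_pairing /= scaler0 addr0.
    by rewrite AD AZ Hu Hv /= scaler0 addr0.
  - by move=> i _; rewrite /d {1}Ae; rewrite -/(d (e i)) {2}/d Ae.
have sE0 x y : ⁅(x, 0) : s, (y, 0)⁆ = (⁅x, y⁆, 0).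
  by rewrite sE /= !lfunE subr0 addr0.
have sEh (h : subvs_of t) x : ⁅(0, h) : s, (x, 0)⁆ = (vsval h x, 0).
  by rewrite sE /= lie0l linear0 subr0 add0r.
have de i : exists a, d (e i) = a *: e i by rewrite /d Ae; eexists.
have dHE x : linfun dH x = d x by rewrite lfunE.
have dt : linfun dH \in t.
  apply/tP; split.
    move=> x y; rewrite !dHE; have := congr1 fst (Ad (x, 0) (y, 0)).
    by rewrite sE0 !AE !sE0.
  apply: eq_frame => i; rewrite !comp_lfunE De linearZ /= !dHE.
  have [a ->] := de i; have -> : D (a *: e i) = a *: D (e i) by exact: linearZ.
  by rewrite De !scalerA mulrC.
(* [h] and [d] are both diagonal, so their contributions to [A] of [h, e_i] cancel and the torus
   component of [A (0, h)] kills every e_i. *)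
have Ah0 h : A (0, h) = 0.
  have Ex : A (0, h) = (0, (A (0, h)).2) by rewrite [LHS]surjective_pairing Ah.
  rewrite Ex; congr pair; apply: sub0 => i.
  have := Ad (0, h) (e i, 0); rewrite Ex; move: (A (0, h)).2 => h'.
  rewrite sEh !AE !sEh => /(congr1 fst) /=; have [a da] := de i.
  move: (tdiag _ i (subvsP h)); move: (co n e i _) => b hb.
  have dZ x : d (b *: x) = b *: d x by rewrite -!dHE linearZ.
  have hZ x : vsval h (a *: x) = a *: vsval h x by exact: linearZ.
  rewrite hb dZ da hZ hb !scalerA mulrC => /eqP.
  by rewrite -subr_eq0 opprD addrCA subrr addr0 oppr_eq0 => /eqP.
(* [A] is the bracket with (0, d), and [Del] is [A] minus the bracket with (y0, 0). *)
exists ((- y0, Subvs dt) : s); apply/lfunP => -[x h].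
rewrite DelE [RHS]lfunE /= !sE /=.
have -> : (x, h) = (x, 0) + (0, h) :> s by rewrite [RHS]surjective_pairing /= addr0 add0r.
rewrite AD Ah0 addr0 AE [LHS]surjective_pairing /= subr0; congr pair.
by rewrite zero_lfunE addr0 lieNl dHE linearN opprK opprB addrA addrC addrA.
Qed.
End SimpleSpectrum.

(** * Gradings of the listed algebras by distinct positive weights *)

Section CompletableTables.
Variables (K : numFieldType) (L : lieAlgType K).

(** Positive integers remain nonzero and distinct in characteristic 0. A zero bracket may be given
    with c = 0 or with m outside [1, n], so table entries that fall off the frame carry no weight
    condition. *)
Lemma completable_nat_weights n (e : nat -> L) (w : nat -> nat) : frame n e ->
  (forall i, (0 < i <= n)%N -> (0 < w i)%N) ->
  (forall i j, (0 < i <= n)%N -> (0 < j <= n)%N -> w i = w j -> i = j) ->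
  (forall i j, (0 < i)%N -> (i < j)%N -> (j <= n)%N -> exists c m,
     ⁅e i, e j⁆ = c *: e m /\ (c != 0 -> (0 < m <= n)%N -> w m = (w i + w j)%N)) ->
  completable L.
Proof.
move=> he w0 wi wg; apply: (completable_simple_spectrum (w := fun i => (w i)%:R) he).
- by move=> i iP; rewrite pnatr_eq0 -lt0n w0.
- by move=> i j iP jP /eqP; rewrite eqr_nat => /eqP/wi; apply.
- move=> i j l i0 ij jn; have [c [m [-> cm]]] := wg i j i0 ij jn => H.
  have [lP|lP] := boolP (0 < l <= n)%N; last by rewrite co_out in H.
  move: H; rewrite coZ co_frame //; case: eqP => [lm|]; last by rewrite mulr0.
  by rewrite lm in lP *; rewrite mulr1 => /eqP c0; rewrite -natrD cm // c0.
Qed.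

Lemma comb0 n (e : nat -> L) : comb e (0 : 'rV_n) = 0.
Proof. by rewrite /comb big1 // => u _; rewrite mxE scale0r. Qed.

Lemma combZ n (e : nat -> L) a (v : 'rV_n) : comb e (a *: v) = a *: comb e v.
Proof. by rewrite -[a *: v]addr0 comb_linear comb0 addr0. Qed.

Lemma completable_L n (e : nat -> L) :
  frame n e -> presents (L_table K n) e -> completable L.
Proof.
move=> he pe; apply: (completable_nat_weights (w := id) he) => [i|i j|i j i0 ij jn].
- by case/andP.
- by [].
rewrite pe // /L_table; case: ifP => H.
  by exists 1, j.+1; rewrite comb_basis // scale1r; split=> // _ _; lia.
by exists 0, 0%N; rewrite scale0r comb0 eqxx.
Qed.

(** [Y_i, Y_j] is a multiple of Y_(i+j+k-2), so weight 1 for Y_1 and k + i - 2 for the other Y_i are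
    additive; k >= 2 separates Y_1 from Y_2. *)
Lemma completable_A n k lam a (e : nat -> L) : (2 <= k)%N ->
  frame n e -> presents (A_table n k lam a) e -> completable L.
Proof.
move=> k2 he pe.
apply: (completable_nat_weights (w := fun i => if i == 1 then 1 else k + i - 2)%N he)
  => [i iP|i j iP jP|i j i0 ij jn].
- by case: ifP; lia.
- by case: ifP; case: ifP; lia.
rewrite pe // /A_table; case: ifP => i1.
  case: ifP => H; last by exists 0, 0%N; rewrite scale0r comb0 eqxx.
  by exists 1, j.+1; rewrite comb_basis // scale1r; split=> // _ _; rewrite !ifF; lia.
case: ifP => ji.
  case: ifP => H; last by exists 0, 0%N; rewrite scale0r comb0 eqxx.
  eexists; eexists; rewrite combZ comb_basis //; split; first by [].
  by move=> _ _; rewrite !ifF; lia.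
case: ifP => H; last by exists 0, 0%N; rewrite scale0r comb0 eqxx.
eexists; eexists; rewrite combZ comb_basis //; split; first by [].
by move=> _ _; rewrite !ifF; lia.
Qed.

(** The weights of family A serve again, except that the pairing of Y_i with Y_(n+1-i) requires (k +
    i - 2) + (k + n - 1 - i) = 2k + n - 3 for Y_n. *)
Lemma completable_B n k lam a (e : nat -> L) : (2 <= k)%N ->
  frame n e -> presents (B_table n k lam a) e -> completable L.
Proof.
move=> k2 he pe.
apply: (completable_nat_weights (w := fun i => if i == 1 then 1 else
   if i == n then 2 * k + n - 3 else k + i - 2)%N he) => [i iP|i j iP jP|i j i0 ij jn].
- by case: ifP => ?; first lia; case: ifP; lia.
- by case: ifP => ?; case: ifP => ?; try case: ifP => ?; try case: ifP => ?; lia.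
rewrite pe // /B_table; case: ifP => i1.
  case: ifP => H; last by exists 0, 0%N; rewrite scale0r comb0 eqxx.
  by exists 1, j.+1; rewrite comb_basis // scale1r; split=> // _ _; rewrite !ifF; lia.
case: ifP => Hn.
  eexists; eexists; rewrite combZ comb_basis //; split; first by [].
  by move=> _ _; rewrite eqxx !ifF; lia.
case: ifP => ji.
  case: ifP => H; last by exists 0, 0%N; rewrite scale0r comb0 eqxx.
  eexists; eexists; rewrite combZ comb_basis //; split; first by [].
  (* i <= t yields 2i + k - 1 <= n - 1, so the exceptional weight of Y_n does not interfere. *)
  have := H; rewrite /B_t => ? _ _; rewrite !ifF; lia.
case: ifP => H; last by exists 0, 0%N; rewrite scale0r comb0 eqxx.
eexists; eexists; rewrite combZ comb_basis //; split; first by [].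
by move=> _ _; rewrite !ifF; lia.
Qed.

(* Replacing Y_1 by Y_1 + Y_2 kills the bracket [Y_1, Y_(n-1)] = Y_n, which is
   what makes a grading by distinct weights possible. *)
Lemma completable_Q p (e : nat -> L) :
  frame p.*2 e -> presents (Q_table K p) e -> completable L.
Proof.
set n := p.*2 => he pe.
have [p0|p0] := posnP p.
  by apply: (completable_nat_weights (w := id) he); rewrite /n p0 => *; lia.
pose e' i := if i == 1%N then e 1%N + e 2%N else e i.
have he' : frame n e'.
  apply: (frame_triangular he) => i iP; rewrite /e'.
  - case: eqP => i1; last exact: frame_out he _ iP.
    by rewrite i1 in iP; lia.
  - by case: eqP => [->|]; [apply: flag1 | move=> _; apply: flag_frame].
  - case: ifP => [/eqP->|_]; last by rewrite co_frame // eqxx oner_eq0.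
    by rewrite coD !co_frame ?addr0 ?oner_eq0 //; lia.
(* The pairing of e_i with e_(n+1-i) imposes weight n + 1 on e_n, which agrees with the chain since
   that now ends at e_(n-1). *)
apply: (completable_nat_weights (w := fun i => if i == n then n.+1 else i)%N he')
  => [i|i j iP jP|i j i0 ij jn].
- by case: ifP; lia.
- by case: ifP; case: ifP; lia.
have e'j : e' j = e j by rewrite /e' ifF //; lia.
have [i1|i1] := eqVneq i 1%N; last first.
  rewrite e'j {1}/e' (negPf i1) pe // /Q_table (negPf i1).
  case: ifP => H; last by exists 0, 0%N; rewrite scale0r comb0 eqxx.
  exists ((-1) ^+ i.+1), n; rewrite combZ comb_basis //.
  rewrite /e' (_ : (n == 1)%N = false); last by lia.
  by split=> // _ _; rewrite eqxx !ifF; lia.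
rewrite e'j i1 {1}/e' eqxx lieDl pe ?jn //; last by lia.
have [j2|j2] := eqVneq j 2%N.
  rewrite j2 liexx addr0 /Q_table eqxx; case: ifP => H.
    exists 1, 3%N; rewrite scale1r comb_basis // /e'; split=> // _ _.
    by rewrite !ifF //; lia.
  by exists 0, 0%N; rewrite scale0r comb0 eqxx.
rewrite pe //; try lia.
have jn1 : (j == n.-1) || (j == n) || (j < n.-1)%N by lia.
rewrite /Q_table /= -/n; case/orP: jn1 => [/orP[/eqP jE|/eqP jE]|jl].
- exists 0, 0%N; rewrite scale0r eqxx; split=> //.
  rewrite ifT; last by lia.
  rewrite ifT; last by lia.
  rewrite combZ !comb_basis // jE prednK; last by lia.
  by rewrite exprS sqrrN expr1n mulr1 scaleN1r subrr.
- exists 0, 0%N; rewrite scale0r eqxx; split=> //.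
  by rewrite !ifF ?comb0 ?addr0 //; lia.
- exists 1, j.+1; rewrite scale1r ifT; last by lia.
  rewrite ifF; last by lia.
  rewrite comb0 addr0 comb_basis // /e'; split; first by rewrite ifF //; lia.
  by move=> _ _; rewrite !ifF //; lia.
Qed.

End CompletableTables.

(** * Filiform algebras and their lower central series *)

Section FiliformFlag.
Variables (K : fieldType) (L : lieAlgType K).
Implicit Types (x y z : L).

Lemma lie_prodP (U V : {vspace L}) x y : x \in U -> y \in V -> ⁅x, y⁆ \in lie_prod U V.
Proof.
move=> xU yV; rewrite (coord_vbasis xU) (coord_vbasis yV) lie_suml.
apply: memv_suml => i _; rewrite lieZl; apply: memvZ; rewrite lie_sumr.
apply: memv_suml => j _; rewrite lieZr; apply: memvZ; apply: memv_span.
by apply/allpairsP; exists ((vbasis U)`_i, (vbasis V)`_j); rewrite !mem_nth ?size_tuple.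
Qed.

Lemma lie_prod_min (U V W : {vspace L}) :
  (forall x y, x \in U -> y \in V -> ⁅x, y⁆ \in W) -> (lie_prod U V <= W)%VS.
Proof.
move=> H; apply/span_subvP => _ /allpairsP[[x y] /= [xU yV ->]].
by apply: H; apply: vbasis_mem.
Qed.

Lemma lower_centralS m x y : y \in lower_central L m -> ⁅x, y⁆ \in lower_central L m.+1.
Proof. by move=> ym; apply: lie_prodP => //; apply: memvf. Qed.

Lemma lower_central_le m : (lower_central L m.+1 <= lower_central L m)%VS.
Proof.
elim: m => [|m IH]; first exact: subvf.
apply: lie_prod_min => x y _ ym; apply: lower_centralS.
exact: (subvP IH).
Qed.

(** A term contained in its successor is contained in all later ones, one of which is 0. *)
Lemma nilpotent_stationary m : nilpotent L ->
  (lower_central L m <= lower_central L m.+1)%VS -> lower_central L m = 0%VS.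
Proof.
case=> N HN Hm; apply/eqP; rewrite -subv0 -HN.
have H k : (lower_central L (m + k) <= lower_central L (m + k).+1)%VS.
  elim: k => [|k IH]; first by rewrite addn0.
  rewrite addnS; apply: lie_prod_min => x y _ yk; apply: lower_centralS.
  exact: (subvP IH).
have {H} : (lower_central L m <= lower_central L (m + N))%VS.
  elim: N {HN} => [|k IH]; first by rewrite addn0.
  by apply: subv_trans IH _; rewrite addnS.
move/subv_trans; apply; elim: m {Hm} => [|m IH]; first exact: subvv.
by rewrite addSn; apply: subv_trans (lower_central_le _) IH.
Qed.

(** There is no upper bound on [i]: for a frame, the case i = n says that e_1 commutes with e_n. *)
Definition chain (e : nat -> L) := forall i, (2 <= i)%N -> ⁅e 1, e i⁆ = e i.+1.

Variables (n : nat) (e : nat -> L).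
Hypotheses (he : frame n e) (ce : chain e) (nilL : nilpotent L).
Hypothesis e1d : e 1%N \notin derived L.

Local Notation flag := (flag n e).
Local Notation co := (co n e).
Local Notation C := (lower_central L).

Lemma chain_lower_central m i : (0 < m)%N -> (m + 2 <= i)%N -> e i \in C m.
Proof.
elim: m i => // m IH i _ mi; have -> : i = i.-1.+1 by lia.
rewrite -ce; last by lia.
apply: lower_centralS; case: m IH mi => [|m] IH mi; first exact: memvf.
by apply: IH; lia.
Qed.

Lemma flag_lower_central m x : (0 < m)%N -> flag (m + 2) x -> x \in C m.
Proof.
move=> m0; apply: (@frame_ind _ _ _ _ he (fun x => x \in C m)) => [|a u v|i mi _]; first exact: mem0v.
  by move=> *; rewrite memvD ?memvZ.
exact: chain_lower_central.
Qed.

(** If some x in [L, L] had a nonzero coordinate on e_2, then L = K e_1 + [L, L], so [L, L] would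
    lie in the next term of the lower central series and vanish. If only the coordinate on e_1 were
    nonzero, e_1 would lie in [L, L]. *)
Lemma derived_flag x : x \in derived L -> flag 3 x.
Proof.
move=> xd; have [x2|x2] := eqVneq (co 2 x) 0.
  have [x1|x1] := eqVneq (co 1 x) 0.
    by apply: flagS => //; apply: flagS => //; apply: flag1.
  case/negP: e1d; rewrite -[e 1%N](scalerK x1) memvZ //.
  have -> : co 1 x *: e 1%N = x - (x - co 1 x *: e 1%N) by rewrite opprB addrC subrK.
  rewrite memvB // (@flag_lower_central 1) //=.
  apply: flagS; first exact: (flag_tail he (flag1 n e x)).
  by rewrite coB coZ x2 co_frame_ne // mulr0 subrr.
have n2 : (2 <= n)%N by rewrite leqNgt; apply: contraNN x2 => n2; rewrite co_out //; lia.
exfalso; suff x0 : x = 0 by rewrite x0 co0 eqxx in x2.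
have dec y : exists a, y - a *: e 1%N \in C 1.
  pose b := co 2 y / co 2 x; pose a := co 1 y - b * co 1 x; exists a.
  rewrite -(subrK (b *: x) (y - _)) memvD ?memvZ // (@flag_lower_central 1) //.
  have [n1|n0] := ltnP 0 n; last by move=> k; rewrite co_out; lia.
  apply: flagS; first (apply: flagS; first exact: flag1).
    by rewrite !coB !coZ co_frame //= /a; ring.
  by rewrite !coB !coZ co_frame //= mulr0 subr0 /b divfK // subrr.
have C12 : (C 1 <= C 2)%VS.
  apply: lie_prod_min => y z _ _; have [a ya] := dec y; have [b zb] := dec z.
  rewrite -(subrK (a *: e 1%N) y) -(subrK (b *: e 1%N) z).
  move: (y - _) (z - _) ya zb => u v uC vC.
  rewrite lieDl !lieDr !(lieZl, lieZr) liexx !scaler0 addr0 (lieC u (e 1%N)).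
  by rewrite !memvD ?memvZ ?memvN ?lower_centralS.
by apply/eqP; rewrite -memv0 -(nilpotent_stationary nilL C12).
Qed.

(** By induction x lies in F_(m+1); a nonzero coordinate there would put [C (m - 1)] inside [C m],
    hence make it 0, although it contains e_(m+1). *)
Lemma lower_central_flag m x : (0 < m)%N -> x \in C m -> flag (m + 2) x.
Proof.
elim: m x => // -[|m] IH x _ xm; first exact: derived_flag.
have Fx : flag (m.+1 + 2) x by apply: IH => //; apply: (subvP (lower_central_le _)).
rewrite addSn; apply: flagS => //; have [//|xn] := eqVneq (co (m.+1 + 2) x) 0.
have iP : (0 < m.+1 + 2 <= n)%N by apply/negPn/negP => iP; rewrite co_out ?eqxx in xn.
case/negP: (frame_neq0 he iP).
suff H : (C m.+1 <= C m.+2)%VS.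
  by rewrite -memv0 -(nilpotent_stationary nilL H) chain_lower_central.
apply/subvP => y /(IH _ isT) Fy.
pose b := co (m.+1 + 2) y / co (m.+1 + 2) x.
rewrite -(subrK (b *: x) y) memvD ?memvZ // flag_lower_central // addSn.
apply: flagS; first by apply: flagB => //; apply: flagZ.
by rewrite coB coZ /b divfK // subrr.
Qed.

Lemma flag_lie x y : flag 3 ⁅x, y⁆.
Proof. by apply: derived_flag; apply: lie_prodP; apply: memvf. Qed.

Lemma flag_lieS m x y : (2 <= m)%N -> flag m y -> flag m.+1 ⁅x, y⁆.
Proof.
case: m => [|[|[|m]]] // _ Fy; first exact: flag_lie.
have := @lower_central_flag m.+2 ⁅x, y⁆ isT; rewrite addn2; apply.
by apply: lower_centralS; apply: flag_lower_central => //; rewrite addn2.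
Qed.

(** Induction on i through e_(i+1) = [e_1, e_i] and the Leibniz rule. The start i = 2 is
    [flag_lieS], which gains only one step; hence the - 1. *)
Lemma flag_lieD i j x y : (2 <= i)%N -> (2 <= j)%N -> flag i x -> flag j y ->
  flag (i + j - 1) ⁅x, y⁆.
Proof.
move=> i2 j2 Fx.
have base s : forall j y, (2 <= j)%N -> (2 <= s)%N -> flag j y -> flag (s + j - 1) ⁅e s, y⁆.
  elim: s => // s IH k {}y k2 s2 Fy; have [s1|s1] := ltnP 1 s; last first.
    have -> : (s = 1)%N by lia.
    by rewrite add2n subn1; apply: flag_lieS.
  have -> : ⁅e s.+1, y⁆ = ⁅e 1%N, ⁅e s, y⁆⁆ - ⁅e s, ⁅e 1%N, y⁆⁆.
    by rewrite -ce // (lie_leibniz (e 1%N)) addrK.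
  have -> : (s.+1 + k - 1 = (s + k - 1).+1)%N by lia.
  apply: flagB; first by apply: flag_lieS; [lia|apply: IH].
  have -> : ((s + k - 1).+1 = s + k.+1 - 1)%N by lia.
  by apply: IH; [lia|lia|apply: flag_lieS].
move: Fx y; apply: (@frame_ind _ _ _ _ he (fun x => forall y, flag j y -> flag (i + j - 1) ⁅x, y⁆))
  => [z _|a u v Hu Hv z Fz|s si sP z Fz].
- by rewrite lie0l; apply: flag0.
- by rewrite lieDl lieZl; apply: flagL; [apply: Hu|apply: Hv].
by apply: flag_le (base s j z _ _ Fz); lia.
Qed.

End FiliformFlag.

Lemma frame_of_basis (K : fieldType) (L : vectType K) n (e : nat -> L) :
  (forall i, ~~ (0 < i <= n)%N -> e i = 0) ->
  basis_of fullv [seq e i.+1 | i <- iota 0 n] -> frame n e.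
Proof.
by move=> eo be; split=> //; rewrite -val_enum_ord -map_comp in be.
Qed.

(** ad Y kills Y, and its kernel is spanned by the ends u_1 and u_n of the two Jordan blocks. If Y
    has a component on u_1, it can replace u_1. Otherwise Y is a multiple of u_n, which is a bracket
    as soon as n >= 3, so n = 2. *)
Lemma filiform_chain (K : fieldType) (L : lieAlgType K) n : \dim {:L} = n -> filiform L ->
  exists e : nat -> L, [/\ frame n e, chain e, e 1%N \notin derived L & (2 <= n)%N].
Proof.
move=> dn [nilL [[Y Yd [_ /andP[n1 _] [v [sv bv zv]]]] _]]; rewrite dn in n1 bv zv.
have n2 : (2 <= n)%N by lia.
case: v sv bv zv => [|v0 [|v1 []]] //= _ bv zv.
set f := ad Y in bv zv.
have fE x : f x = ⁅Y, x⁆ by rewrite lfunE.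
have f0 : iter n.-1 f v0 = 0 by apply: (zv (v0, n.-1)); rewrite mem_head.
have f1 : f v1 = 0 by apply: (zv (v1, 1%N)); rewrite !inE eqxx orbT.
(* The block of size 1 comes first, the long block occupies the indices from 2 on. *)
pose u i := match i with 0 => 0 | 1 => v1 | i.+2 => iter i f v0 end.
have uS i : (2 <= i)%N -> f (u i) = u i.+1 by case: i => [|[]].
have uo i : ~~ (0 < i <= n)%N -> u i = 0.
  case: i => [|[|i]] // iP; first by lia.
  rewrite /u; have -> : i = (i - n.-1 + n.-1)%N by lia.
  by rewrite iterD f0; elim: (_ - _)%N => //= k ->; rewrite linear0.
have hu : frame n u.
  apply: frame_of_basis => //; move: bv; rewrite (@perm_basis _ _ _ [seq u i.+1 | i <- iota 0 n]) //.
  rewrite -{2}(prednK (ltnW n2)) /= (iotaDl 1 0) -map_comp perm_catC perm_cons.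
  by rewrite perm_refl.
have fu1 : f (u 1%N) = 0 by [].
clearbody u.
have Yu : f Y = 0 by rewrite fE liexx.
have Yi i : (2 <= i < n)%N -> co n u i Y = 0.
  move=> iP; have := congr1 (co n u i.+1) Yu.
  rewrite {1}(comb_co hu Y) linear_sum co_sum co0 => H; rewrite -[RHS]H {H}.
  case: i iP => // i iP; have in' : (i < n)%N by lia.
  rewrite (bigD1 (Ordinal in')) //= big1 ?addr0 => [|j /eqP ji].
    by rewrite linearZ /= uS ?coZ ?co_frame ?eqxx ?mulr1 //; lia.
  rewrite linearZ /= coZ; case: j ji => -[|j] jn ji.
    by rewrite fu1 co0 mulr0.
  rewrite uS // co_frame_ne ?mulr0 //; apply/eqP => -[H].
  by case: ji; apply: val_inj.
have YE : Y = co n u 1 Y *: u 1%N + co n u n Y *: u n.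
  apply: (co_inj hu) => i iP; rewrite coD !coZ !co_frame //.
  have [->|i1] := eqVneq i 1%N; first by rewrite (_ : (1 == n)%N = false) ?mulr0 ?addr0 ?mulr1 //; lia.
  have [->|i3] := eqVneq i n; first by rewrite mulr1 mulr0 add0r.
  by rewrite !mulr0 addr0 Yi //; lia.
have [Y1|Y1] := eqVneq (co n u 1 Y) 0; last first.
  pose e i := if i == 1%N then Y else u i.
  have he : frame n e.
    apply: (frame_triangular hu) => i iP; rewrite /e.
    - by rewrite ifF ?uo //; lia.
    - by case: eqP => [->|_]; [apply: flag1 | apply: flag_frame].
    - by case: ifP => [/eqP->//|_]; rewrite co_frame // eqxx oner_eq0.
  exists e; split=> // i i2; rewrite /e eqxx !ifF; try lia.
  by rewrite -fE uS.
have Yn : Y = co n u n Y *: u n by rewrite {1}YE Y1 scale0r add0r.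
have yn0 : co n u n Y != 0.
  by apply: contraNneq Yd => H; rewrite Yn H scale0r mem0v.
have nE : n = 2%N.
  apply/eqP; rewrite eqn_leq n2 andbT leqNgt; apply: contraNN Yd => n3.
  have un : u n = ⁅Y, u n.-1⁆ by rewrite -fE uS; [congr u; lia | lia].
  by rewrite Yn memvZ // un; apply: lie_prodP; apply: memvf.
pose e i := if i == 1%N then Y else if i == 2%N then u 1%N else 0.
have eo i : ~~ (0 < i <= n)%N -> e i = 0 by move=> iP; rewrite /e !ifF //; lia.
exists e; split=> // [|i i2]; last first.
  case: i i2 => [|[|[|i]]] // _; rewrite /e /= ?lie0r //.
  by rewrite -fE fu1.
rewrite nE in dn hu eo Yn yn0 *; apply: (frame_of_free dn eo) => a.
rewrite !big_ord_recl big_ord0 /= /e /= addr0 Yn => H.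
have := congr1 (co 2 u 1) H; have := congr1 (co 2 u 2) H.
rewrite !coD !coZ !co_frame // !co0 /= !mulr0 !mulr1 add0r addr0.
move=> /eqP; rewrite mulf_eq0 (negPf yn0) orbF => /eqP a1 a2.
by move=> [|[|[|i]]].
Qed.

(* The flags are the members of the lower central series, whence the conditions on
   brackets; replacing e_2 by e_2 - d e_1 removes the e_4-component of [e_2, e_3]. *)
Record adapted (K : fieldType) (L : lieAlgType K) n (e : nat -> L) : Prop := Adapted {
  adapted_frame : frame n e;
  adapted_chain : chain e;
  adapted_lie : forall x y, flag n e 3 ⁅x, y⁆;
  adapted_lieS : forall m x y, (2 <= m)%N -> flag n e m y -> flag n e m.+1 ⁅x, y⁆;
  adapted_lieD : forall i j x y, (2 <= i)%N -> (2 <= j)%N ->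
    flag n e i x -> flag n e j y -> flag n e (i + j - 1) ⁅x, y⁆;
  adapted_e23 : co n e 4 ⁅e 2, e 3⁆ = 0
}.

Lemma filiform_adapted (K : fieldType) (L : lieAlgType K) n : \dim {:L} = n -> filiform L ->
  (2 <= n)%N /\ exists e : nat -> L, adapted n e.
Proof.
move=> dn fL; have [e [he ce e1 n2]] := filiform_chain dn fL; split=> //.
have [nilL _] := fL.
pose d := co n e 4 ⁅e 2, e 3⁆.
pose e' i := if i == 2%N then e 2 - d *: e 1%N else e i.
have e'1 : e' 1%N = e 1%N by [].
have e2E : e 2 = e' 2 + d *: e' 1%N by rewrite /e' /= subrK.
(* [e' 2] may leave F_2, so the triangular criterion does not apply: coordinates 2 to n dispose of
   all coefficients but the first, which is read off last. *)
have he' : frame n e'.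
  apply: (frame_of_free dn) => [i iP|a a0].
    by rewrite /e' ifF ?(frame_out he) //; lia.
  have co_a i : (2 <= i <= n)%N -> a i = 0.
    move=> iP; have := congr1 (co n e i) a0; rewrite co0 co_sum.
    case: i iP => // i iP; have in' : (i < n)%N by lia.
    have coe j : co n e i.+1 (e' j) = (i.+1 == j)%:R.
      rewrite /e'; case: eqP => [->|_]; last by rewrite co_frame //; lia.
      by rewrite coB coZ (co_frame_ne he (j := 1)) ?mulr0 ?subr0 ?co_frame //; lia.
    rewrite (bigD1 (Ordinal in')) //= big1 => [|j /eqP ji].
      by rewrite addr0 coZ coe eqxx mulr1.
    rewrite coZ coe eqSS; case: eqP => [ij|_]; last by rewrite mulr0.
    by case: ji; apply: val_inj.
  move=> i iP; have [->|i1] := eqVneq i 1%N; last by apply: co_a; lia.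
  have := congr1 (co n e 1) a0; rewrite co0 co_sum.
  have n0 : (0 < n)%N by lia.
  rewrite (bigD1 (Ordinal n0)) //= big1 => [|j /eqP ji].
    by rewrite addr0 coZ e'1 co_frame ?eqxx ?mulr1 //; lia.
  rewrite coZ co_a ?mul0r //; have := ltn_ord j; suff : (j : nat) <> 0%N by lia.
  by move=> j0; case: ji; apply: val_inj.
have ce' : chain e'.
  move=> i i2; rewrite e'1 [RHS]/e' ifF; last by lia.
  rewrite /e'; case: eqP => [->|_]; last by rewrite ce.
  by rewrite lieBr lieZr liexx scaler0 subr0 ce.
have coE i x : (2 <= i)%N -> co n e' i x = co n e i x.
  move=> i2; elim/(frame_indT he): x => [|a x y Hx Hy|j jP]; first by rewrite !co0.
    by rewrite !coP Hx Hy.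
  have [iP|iP] := boolP (0 < i <= n)%N; last by rewrite !co_out.
  rewrite [RHS]co_frame //; have [->|j2] := eqVneq j 2%N.
    by rewrite e2E coD coZ !co_frame // (_ : (i == 1)%N = false) ?mulr0 ?addr0 //; lia.
  by rewrite -[e j]/(if false then e 2 - d *: e 1%N else e j) -(negPf j2) -/(e' j) co_frame.
exists e'; split=> //.
- exact: flag_lie.
- exact: flag_lieS.
- exact: flag_lieD.
rewrite coE // /e' /= lieBl lieZl ce // coB coZ -/d.
have [n4|n4] := leqP 4 n; first by rewrite co_frame ?eqxx ?mulr1 ?subrr.
by rewrite /d !co_out ?mulr0 ?subrr //; lia.
Qed.

(** * Leading structure constants (Vergne's argument) *)

Section StructureConstants.
Variables (K : numFieldType) (L : lieAlgType K) (n : nat) (e : nat -> L).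
Hypothesis ae : adapted n e.

Let he := adapted_frame ae.
Let ce := adapted_chain ae.

Local Notation co := (co n e).
Local Notation flag := (flag n e).

(** The coefficient in the lowest degree allowed by [adapted_lieD]: a structure constant of the
    graded algebra of the lower central series. *)
Let d i j := co (i + j - 1)%N ⁅e i, e j⁆.

Lemma co_ad1 m x : (2 <= m < n)%N -> co m.+1 ⁅e 1%N, x⁆ = co m x.
Proof.
move=> mP; elim/(frame_indT he): x => [|a x y Hx Hy|j jP]; first by rewrite lie0r !co0.
  by rewrite lieDr lieZr !coP Hx Hy.
have [->|j1] := eqVneq j 1%N; first by rewrite liexx co0 co_frame_ne //; lia.
by rewrite ce ?co_frame ?eqSS //; lia.
Qed.

Lemma co_lie_flag i m x : (2 <= i)%N -> (2 <= m)%N -> flag m x ->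
  co (i + m - 1)%N ⁅e i, x⁆ = co m x * d i m.
Proof.
move=> i2 m2 Fx; have Ft := flag_tail he Fx.
rewrite -{1}(subrK (co m x *: e m) x) lieDr coD lieZr coZ.
by rewrite (adapted_lieD ae i2 _ (flag_frame he (leqnn i)) Ft) ?add0r //; lia.
Qed.

Let d_rec i j : (2 <= i)%N -> (2 <= j)%N -> (i + j <= n)%N ->
  d i j = d i.+1 j + d i j.+1.
Proof.
move=> i2 j2 ijn; rewrite /d.
have -> : (i.+1 + j - 1 = (i + j - 1).+1)%N by lia.
have -> : (i + j.+1 - 1 = (i + j - 1).+1)%N by lia.
by rewrite -coD -(ce i2) -(ce j2) -lie_leibniz co_ad1 //; lia.
Qed.

(** Vanishing on level s - 1 turns [d_rec] into d (i+1) j = - d i (j+1), so level s is an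
    alternating sequence with a single parameter. *)
Let d_alt (s : nat) : (s <= n.+1)%N -> (4 < s)%N ->
  (forall i j, (2 <= i)%N -> (2 <= j)%N -> (i + j = s.-1)%N -> d i j = 0) ->
  forall i, (2 <= i)%N -> (i + 2 <= s)%N -> d i (s - i) = (-1) ^+ i * d 2 (s - 2).
Proof.
move=> sn s4 d0; elim=> [//|[//|[_ _|i IH _ iP]]]; first by rewrite expr2 mulrNN !mul1r.
have := d0 i.+2 (s - i.+3)%N isT ltac:(lia) ltac:(lia).
rewrite d_rec; try lia.
have -> : ((s - i.+3).+1 = s - i.+2)%N by lia.
rewrite IH; try lia.
by move/eqP; rewrite addr_eq0 => /eqP->; rewrite [in RHS]exprS mulN1r mulNr.
Qed.

(** For even s the alternating sequence passes through d (s/2) (s/2) = 0. *)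
Let d_even (s : nat) : (s <= n.+1)%N -> (4 <= s)%N -> ~~ odd s ->
  (forall i j, (2 <= i)%N -> (2 <= j)%N -> (i + j = s.-1)%N -> d i j = 0) ->
  forall i, (2 <= i)%N -> (i + 2 <= s)%N -> d i (s - i) = 0.
Proof.
move=> sn s4 se d0 i i2 is2.
have dd m : d m m = 0 by rewrite /d liexx co0.
have [s5|s5] := ltnP 4 s; last by have -> : (s - i = i)%N by lia.
rewrite d_alt //; have := d_alt sn s5 d0 (i := s./2).
have -> : (s - s./2 = s./2)%N by lia.
by rewrite dd => /(_ ltac:(lia) ltac:(lia))/esym/eqP; rewrite mulf_eq0 signr_eq0 /= => /eqP->; rewrite mulr0.
Qed.

(* For odd s = 2m - 1 the next level gives d 2 (s - 1) = (m - 2) d 2 (s - 2), and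
   the Jacobi identity for e_2, e_3, e_(s-3) makes the product of both vanish. *)
Lemma structure_vanish (i j : nat) : (2 <= i)%N -> (2 <= j)%N -> (i + j <= n)%N ->
  co (i + j - 1)%N ⁅e i, e j⁆ = 0.
Proof.
rewrite -/(d i j) => i2 j2 ijn; move: {-2}(i + j)%N (erefl (i + j)%N) => s.
elim/ltn_ind: s i j i2 j2 ijn => s IH i j i2 j2 ijn ijs.
have d0 i' j' : (2 <= i')%N -> (2 <= j')%N -> (i' + j' < s)%N -> d i' j' = 0.
  by move=> *; apply: (IH (i' + j')%N) => //; lia.
have ds i' j' : (2 <= i')%N -> (2 <= j')%N -> (i' + j' = s.-1)%N -> d i' j' = 0.
  by move=> *; apply: d0; lia.
have -> : (j = s - i)%N by lia.
have [so|se] := boolP (odd s); last by apply: d_even => //; lia.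
rewrite d_alt //; try lia.
suff -> : d 2 (s - 2) = 0 by rewrite mulr0.
(* Level 5 is settled by the normalization of e_2. *)
have [s5|s5] := leqP s 5.
  have -> : (s = 5)%N by lia.
  exact: adapted_e23 ae.
pose m := s.+1./2; have sm : (s = 2 * m - 1)%N by rewrite /m; lia.
set D := d 2 (s - 2).
(* Level s + 1, read from the middle where d m m = 0: each use of [d_rec] adds one term of the
   alternating level s, that is, one [D]. *)
have E r : (r + 2 <= m)%N -> (-1) ^+ (m - r) * d (m - r) (m + r) = r%:R * D.
  elim: r => [|r IHr] rm; first by rewrite subn0 addn0 /d liexx co0 mulr0 mul0r.
  have dr : d (m - r.+1) (m + r) = (-1) ^+ (m - r.+1) * D.
    by rewrite -(d_alt _ _ ds) ?sm; try lia; congr d; lia.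
  rewrite d_rec in dr; try lia.
  have mr : ((m - r.+1).+1 = m - r)%N by lia.
  rewrite mr in dr; have := IHr ltac:(lia).
  rewrite -mr exprS mulN1r mulNr => {}IHr.
  rewrite addnS -[X in _ * X](addKr (d (m - r.+1).+1 (m + r))) mr dr mulrDr -mr mulrN IHr.
  by rewrite mulrA -expr2 sqrr_sign mul1r -natr1 mulrDl mul1r addrC.
have d2 : d 2 (s - 1) = (m - 2)%:R * D.
  rewrite -E; last by lia.
  have -> : (m - (m - 2) = 2)%N by lia.
  by rewrite sqrrN expr1n mul1r; congr d; lia.
pose l := (s - 3)%N.
have F3l : flag (s - 1) ⁅e 3, e l⁆.
  have -> : (s - 1 = 3 + l - 1)%N by lia.
  by apply: (adapted_lieD ae); try (exact: (flag_frame he)); lia.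
(* Only [e_2, [e_3, e_l]] has a coordinate on e_s. The other two terms lie in F_(s+1), because
   [e_2, e_3] is in F_5 and [e_2, e_l] in F_(l+2). *)
have := congr1 (co s) (lie_leibniz (e 2) (e 3) (e l)).
have {1}-> : s = (2 + (s - 1) - 1)%N by lia.
rewrite co_lie_flag //; last by lia.
rewrite coD (_ : co s ⁅⁅e 2, e 3⁆, e l⁆ = 0) ?add0r; last first.
  have F5 : flag 5 ⁅e 2, e 3⁆.
    apply: flagS; last exact: adapted_e23 ae.
    by apply: (adapted_lieD ae (i := 2) (j := 3)) => //; apply: (flag_frame he).
  apply: (adapted_lieD ae (i := 5) (j := l)) => //; [lia|exact: (flag_frame he)|lia].
rewrite (_ : co s ⁅e 3, ⁅e 2, e l⁆⁆ = 0); last first.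
  have F2l : flag l.+2 ⁅e 2, e l⁆.
    apply: flagS; first by apply: (adapted_lieS ae); [lia|apply: (flag_frame he)].
    have -> : l.+1 = (2 + l - 1)%N by lia.
    by apply: d0; lia.
  by apply: (adapted_lieD ae (i := 3) (j := l.+2)) => //; [exact: (flag_frame he)|lia].
have -> : co (s - 1)%N ⁅e 3, e l⁆ = - D.
  have -> : (s - 1 = 3 + l - 1)%N by lia.
  rewrite -/(d 3 l) d_alt //; try lia.
  by rewrite -[RHS]mulN1r; congr (_ * _); ring.
move/eqP; rewrite d2 mulf_eq0 oppr_eq0 mulf_eq0 pnatr_eq0 => /orP[/eqP//|/orP[|/eqP//]].
lia.
Qed.

(** Level n + 1 still alternates, as level n vanishes, but no further level exists to force its
    parameter delta to be 0. *)
Lemma co_lie_top i : (4 <= n)%N -> (2 <= i < n)%N ->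
  co n ⁅e i, e (n.+1 - i)%N⁆ = (-1) ^+ i * co n ⁅e 2, e n.-1⁆.
Proof.
move=> n4 iP; have := @d_alt n.+1 (leqnn _) ltac:(lia) _ i.
rewrite /d; have -> : (i + (n.+1 - i) - 1 = n)%N by lia.
have -> : (2 + (n.+1 - 2) - 1 = n)%N by lia.
have -> : (n.+1 - 2 = n.-1)%N by lia.
by apply; try lia; move=> *; apply: structure_vanish; lia.
Qed.

Lemma lie_top_odd : (4 <= n)%N -> odd n -> co n ⁅e 2, e n.-1⁆ = 0.
Proof.
move=> n4 no; have := co_lie_top n4 (i := n.+1./2) ltac:(lia).
have -> : (n.+1 - n.+1./2 = n.+1./2)%N by lia.
by rewrite liexx co0 => /esym/eqP; rewrite mulf_eq0 signr_eq0 => /eqP.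
Qed.

Lemma adapted_lie_gt i j x y : (2 <= i)%N -> (2 <= j)%N ->
  (4 <= n)%N -> (i + j <= n)%N \/ co n ⁅e 2, e n.-1⁆ = 0 ->
  flag i x -> flag j y -> flag (i + j) ⁅x, y⁆.
Proof.
move=> i2 j2 n4 H Fx Fy; have -> : (i + j = (i + j - 1).+1)%N by lia.
apply: flagS; first exact: adapted_lieD.
have Ft := flag_tail he Fx.
rewrite -{1}(subrK (co i x *: e i) x) lieDl coD lieZl coZ co_lie_flag //.
rewrite (adapted_lieD ae (i := i.+1) _ j2 Ft Fy) ?add0r; try lia.
suff -> : d i j = 0 by rewrite !mulr0.
have [ijn|ijn] := leqP (i + j) n; first exact: structure_vanish.
case: H => [|D0]; first by lia.
have [ijE|ijN] := eqVneq (i + j)%N n.+1; last by rewrite /d co_out //; lia.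
rewrite /d ijE subn1 /=; have -> : (j = n.+1 - i)%N by lia.
by rewrite co_lie_top ?D0 ?mulr0 //; lia.
Qed.

End StructureConstants.

(** * Eigenvectors of a torus and graded bases *)

Section Eigenvectors.
Variables (K : fieldType) (V : lieAlgType K) (D : 'End(V)).
Implicit Types (x y : V) (U W : V -> Prop).

Definition subspace U := U 0 /\ forall a x y, U x -> U y -> U (a *: x + y).

Definition stable U := forall x, U x -> U (D x).

Let op s : 'End(V) := foldr (fun b f => f \o (D - b *: \1))%VF \1%VF s.

Let opS b s x : op (b :: s) x = op s (D x - b *: x).
Proof. by rewrite /= comp_lfunE add_lfunE opp_lfunE scale_lfunE id_lfunE. Qed.

Let op_comm s x : op s (D x) = D (op s x).
Proof. by elim: s x => [|b s IH] x; rewrite ?id_lfunE // !opS -IH !linearB !linearZ. Qed.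

(** x is killed by a product of factors D - a with distinct a. Factors are applied while the result
    stays outside W. Once (D - a) x falls into W, the remaining factors D - c send x to an
    eigenvector for a, congruent modulo W to x times the product of the a - c, which is nonzero. *)
Lemma exists_eigenvector U W : diagonalizable_end D ->
  subspace U -> stable U -> subspace W -> stable W ->
  forall x, U x -> ~ W x -> exists y a, [/\ U y, ~ W y & D y = a *: y].
Proof.
case=> b bb bD [U0 UL] sU [W0 WL] sW x Ux Wx.
have [s us sD] : exists2 s : seq K, uniq s & forall v, v \in b ->
    exists2 a, a \in s & D v = a *: v.
  have {bb} [s sD] : exists s : seq K, forall v, v \in b ->
      exists2 a, a \in s & D v = a *: v.
    elim: b bD {bb} => [|v b IH] bD; first by exists [::].
    have [v' v'b|s sD] := IH; first by apply: bD; rewrite inE v'b orbT.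
    have [a av] := bD v (mem_head _ _); exists (a :: s) => v'.
    rewrite inE => /orP[/eqP->|/sD[a' a's Dv]]; first by exists a; rewrite ?mem_head.
    by exists a'; rewrite // inE a's orbT.
  exists (undup s); rewrite ?undup_uniq // => v /sD[a sa Da].
  by exists a; rewrite ?mem_undup.
have opE r a y : D y = a *: y -> op r y = (\prod_(c <- r) (a - c)) *: y.
  move=> Dy; elim: r => [|c r IH]; first by rewrite big_nil scale1r id_lfunE.
  by rewrite opS Dy -scalerBl linearZ /= IH big_cons scalerA.
have op0 : op s x = 0.
  have : x \in <<in_tuple b>>%VS by rewrite (span_basis bb) memvf.
  move/coord_span => ->; rewrite linear_sum big1 // => i _; rewrite linearZ /=.
  have [a sa Da] := sD _ (mem_nth 0 (ltn_ord i)).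
  by rewrite (opE _ _ _ Da) (big_rem a) //= subrr mul0r scale0r scaler0.
have UD u v : U u -> U v -> U (u + v) by move=> *; rewrite -[u]scale1r; apply: UL.
have WB u v : W u -> W v -> W (v - u).
  by move=> *; rewrite addrC -scaleN1r; apply: WL.
elim: s us {sD opE} x Ux Wx op0 => [_ x _ nW|a s IH /= /andP[as_ us] x Ux nW].
  by rewrite id_lfunE => x0; case: nW; rewrite x0.
rewrite opS; set x' := D x - a *: x => x'0.
have Ux' : U x' by rewrite /x' addrC -scaleNr; apply: UL => //; apply: sU.
have [Wx'|nWx'] := classic (W x'); last exact: (IH us x').
exists (op s x), a; split.
- elim: s x Ux {IH as_ us nW x' x'0 Ux' Wx'} => [|c s IH] x Ux; first by rewrite id_lfunE.
  by rewrite opS; apply: IH; rewrite addrC -scaleNr; apply: UL => //; apply: sU.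
- have : W (op s x - (\prod_(c <- s) (a - c)) *: x).
    elim: s x {IH as_ us nW Ux Ux' x'0} @x' Wx' => [|c s IH] x x' Wx'.
      by rewrite id_lfunE big_nil scale1r subrr.
    rewrite opS big_cons; set y := D x - c *: x.
    have Wy : W (y - (a - c) *: x) by rewrite /y scalerBl opprB addrA subrK.
    have Wy' : W (D y - a *: y).
      have -> : D y - a *: y = D x' - c *: x'.
        rewrite /y /x' !linearB !linearZ /= ?scalerBr !scalerA (mulrC c).
        by rewrite addrACA.
      by rewrite addrC -scaleNr; apply: WL => //; apply: sW.
    have := IH _ Wy'; set p := \prod_(_ <- _) _ => Wp.
    rewrite mulrC -scalerA -(subrK (p *: y) (op s y)) -addrA -scalerBr.
    by rewrite addrC; apply: WL.
  set p := \prod_(_ <- _) _ => Wp Wop; case: nW.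
  have p0 : p != 0.
    rewrite prodf_seq_neq0; apply/allP => c cs /=; rewrite subr_eq0.
    by apply: contraNneq as_ => ->.
  have : W (p *: x) by rewrite -[p *: x](subKr (op s x)); apply: WB.
  by move=> H; rewrite -[x](scalerK p0) -[_ *: (p *: x)]addr0; apply: WL.
- have E : op s (a *: x) = a *: op s x by exact: linearZ.
  have : op s (D x) - op s (a *: x) = 0 by rewrite -[RHS]x'0 [RHS]linearB.
  by rewrite E op_comm => /eqP; rewrite subr_eq0 => /eqP.
Qed.

End Eigenvectors.

(** * Subspaces invariant under derivations *)

Section DerivationFlags.
Variables (K : numFieldType) (L : lieAlgType K) (n : nat) (e : nat -> L).
Hypothesis ae : adapted n e.
Variable D : 'End(L).
Hypothesis derD : derivation D.

Let he := adapted_frame ae.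
Let ce := adapted_chain ae.

Local Notation co := (co n e).
Local Notation flag := (flag n e).
Local Notation delta := (co n ⁅e 2, e n.-1⁆).

Lemma subspace_flag m : subspace (flag m).
Proof. by split; [exact: flag0 | exact: flagL]. Qed.

Lemma derivation_flag m : (3 <= m)%N -> stable D (flag m).
Proof.
have De i : (3 <= i)%N -> flag i (D (e i)).
  elim: i => // i IH; rewrite ltnS leq_eqVlt => /orP[/eqP<-|i3].
    by rewrite -ce // derD; apply: flagD; apply: (adapted_lie ae).
  rewrite -ce ?derD; last by lia.
  apply: flagD; apply: (adapted_lieS ae); try lia; first exact: (flag_frame he).
  exact: IH.
move=> m3; apply: (@frame_ind _ _ _ _ he (fun x => flag m (D x))).
- by rewrite linear0; apply: flag0.
- by move=> a x y Fx Fy; rewrite linearP; apply: flagL.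
- by move=> i mi _; exact: flag_le mi (De i (leq_trans m3 mi)).
Qed.

(** [e_2, e_3] has no component on e_4 and [F_3, F_3] lies in F_5. This makes F_2 intrinsic, as the
    set of x with [x, F_3] inside F_5. *)
Lemma co1_lie x : (5 <= n)%N -> co 4 ⁅x, e 3⁆ = co 1 x.
Proof.
move=> n5; elim/(frame_indT he): x => [|a x y Hx Hy|i iP].
- by rewrite lie0l !co0.
- by rewrite lieDl lieZl !coP Hx Hy.
case: i iP => [|[|[|i]]] // iP.
- by rewrite ce // !co_frame //; lia.
- by rewrite (adapted_e23 ae) co_frame_ne.
rewrite co_frame_ne //.
apply: (adapted_lieD ae (i := 3) (j := 3)) => //; exact: (flag_frame he).
Qed.

Lemma derivation_flag2 : (5 <= n)%N -> stable D (flag 2).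
Proof.
move=> n5 x Fx; apply: flagS; first exact: flag1.
rewrite -co1_lie //; have -> : ⁅D x, e 3⁆ = D ⁅x, e 3⁆ - ⁅x, D (e 3)⁆.
  by rewrite derD addrK.
have F3 : flag 3 (e 3) by apply: (flag_frame he).
suff : flag 5 (D ⁅x, e 3⁆ - ⁅x, D (e 3)⁆) by apply.
apply: flagB; first (apply: derivation_flag => //).
  by apply: (adapted_lie_gt ae (i := 2) (j := 3)) => //; [lia | left].
apply: (adapted_lie_gt ae (i := 2) (j := 3)) => //; [lia | by left|].
exact: derivation_flag.
Qed.

(** The linear form whose kernel centralizes F_(n-1): [x, e_(n-1)] lies in F_n, and e_n is
    central. *)
Lemma co_lie_pred x : (4 <= n)%N -> co n ⁅x, e n.-1⁆ = co 1 x + co 2 x * delta.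
Proof.
move=> n4; elim/(frame_indT he): x => [|a x y Hx Hy|i iP].
- by rewrite lie0l !co0 mul0r addr0.
- by rewrite lieDl lieZl !coP Hx Hy; ring.
have [->|i1] := eqVneq i 1%N.
  rewrite ce ?prednK; try lia.
  by rewrite !co_frame ?eqxx ?mul0r ?addr0 //; lia.
have [->|i2] := eqVneq i 2%N.
  by rewrite co_frame_ne // co_frame ?eqxx ?mul1r ?add0r //; lia.
rewrite [in RHS]co_frame_ne 1?eq_sym // co_frame_ne 1?eq_sym // mul0r addr0.
have Fi : flag i (e i) by apply: (flag_frame he).
have Fn : flag n.-1 (e n.-1) by apply: (flag_frame he).
by apply: (adapted_lieD ae _ _ Fi Fn); lia.
Qed.

(* The centralizer of the (n-1)-st flag. *)
Lemma derivation_centralizer : (5 <= n)%N ->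
  stable D (fun x => co 1 x + co 2 x * delta = 0).
Proof.
move=> n5 x; rewrite -!co_lie_pred; try lia.
move=> x0; have -> : ⁅D x, e n.-1⁆ = D ⁅x, e n.-1⁆ - ⁅x, D (e n.-1)⁆.
  by rewrite derD addrK.
have F : flag n.-1 (e n.-1) by apply: (flag_frame he).
have Fn : flag n ⁅x, e n.-1⁆.
  by have := adapted_lieS ae x (m := n.-1) _ F; rewrite prednK; [apply|]; lia.
have -> : ⁅x, e n.-1⁆ = 0 by apply: (flag_gt he (leqnn _)); apply: flagS.
have FD : flag n.-1 (D (e n.-1)) by apply: derivation_flag; [lia|].
have F0 : ⁅x, D (e n.-1) - co n.-1 (D (e n.-1)) *: e n.-1⁆ = 0.
  apply: (flag_gt he (leqnn _)); apply: (adapted_lieS ae); first by lia.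
  by have := flag_tail he FD; rewrite prednK //; lia.
move/eqP: F0; rewrite lieBr subr_eq0 => /eqP->.
by rewrite linear0 add0r coN lieZr coZ x0 mulr0 oppr0.
Qed.

End DerivationFlags.

(** The relation a i (j+1) = a i j - a (i+1) j computes each entry from entries closer to the
    diagonal, so [lam] = 0 forces a = 0. The condition on [t] puts a i (i+1) out of range for i >
    t. *)
Lemma compatible_mktuple (K : fieldType) N k t (a : nat -> nat -> K) :
  (forall i, (t < i)%N -> (N < 2 * i + k - 1)%N) ->
  (forall i j, a i j = - a j i) -> (forall i, a i i = 0) ->
  (forall i j, (2 <= i)%N -> (2 <= j)%N -> (i + j.+1 + k - 2 <= N)%N ->
     a i j = a i j.+1 + a i.+1 j) ->
  (forall i j, (N < i + j + k - 2)%N -> a i j = 0) ->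
  let lam := [tuple a s.+2 s.+3 | s < t.-1] in
  compatible N k t lam a /\
  (~~ has (predC1 0) lam -> forall i j, (2 <= i)%N -> (2 <= j)%N -> a i j = 0).
Proof.
move=> tP aC a0 arec aout lam.
have lamE i : (2 <= i <= t)%N -> lam`_(i - 2) = a i i.+1.
  move=> iP; have it : (i - 2 < t.-1)%N by lia.
  have -> : lam`_(i - 2) = tnth lam (Ordinal it) by rewrite (tnth_nth 0).
  rewrite tnth_mktuple /=.
  by have -> : (i - 2).+2 = i by lia.
split; first by split=> // i /lamE.
move=> /hasPn l0.
have diag i : (2 <= i)%N -> a i i.+1 = 0.
  move=> i2; have [it|ti] := leqP i t; last by apply: aout; have := tP i ti; lia.
  have := l0 (lam`_(i - 2)); rewrite mem_nth ?size_tuple; last by lia.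
  by move=> /(_ isT) /negPn/eqP <-; rewrite lamE // i2.
have up r i : (2 <= i)%N -> a i (i + r)%N = 0.
  elim/ltn_ind: r i => -[|[|r]] IH i i2; first by rewrite addn0.
    by rewrite addn1 diag.
  have [ijN|ijN] := leqP (i + (i + r.+2) + k - 2) N; last exact: aout.
  have := @arec i (i + r.+1)%N i2 ltac:(lia).
  rewrite -addnS => /(_ ijN)/eqP; rewrite IH // eq_sym addr_eq0.
  have -> : (i + r.+1 = i.+1 + r)%N by lia.
  have -> : a i.+1 (i.+1 + r)%N = 0 by apply: IH; lia.
  by rewrite oppr0 => /eqP.
move=> i j i2 j2; have [ij|ji] := leqP i j.
  by rewrite -(subnKC ij) up.
by rewrite aC -(subnKC (ltnW ji)) up ?oppr0.
Qed.

(** * From weights to the parameters k, lambda, a *)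

Section GradedBrackets.
Variables (K : numFieldType) (L : lieAlgType K) (n N : nat) (e : nat -> L).
Variables (S : nat -> nat -> bool) (alpha beta : K) (t : nat -> nat).
Hypotheses (he : frame n e) (Nn : (N <= n)%N).
Hypothesis chainN : forall i, (2 <= i < N)%N -> ⁅e 1%N, e i⁆ = e i.+1.
Hypothesis SN : forall i j, (i + j <= N)%N -> S i j.
Hypothesis alpha0 : alpha != 0.
Hypothesis graded : forall i j l, (2 <= i)%N -> (2 <= j)%N -> S i j ->
  co n e l ⁅e i, e j⁆ != 0 ->
  [/\ (l <= N)%N, (i + j <= l)%N & (l - (i + j) + 2)%:R * alpha = beta].
Hypothesis tP : forall k i, (2 <= k)%N -> (t k < i)%N -> (N < 2 * i + k - 1)%N.

(** Serves both families: [N] is where the chain ends (n for A, n - 1 for B), and [S] selects the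
    pairs described (all of them, or those with i + j <> n + 1). One nonzero bracket fixes k by beta
    = k alpha; as alpha <> 0, every other bracket then has only the degree i + j + k - 2
    available. *)
Lemma graded_brackets :
  (forall i j, (2 <= i)%N -> (2 <= j)%N -> S i j -> ⁅e i, e j⁆ = 0) \/
  exists k (lam : (t k).-1.-tuple K) a,
    [/\ (2 <= k)%N && (k + 3 <= N)%N, has (predC1 0) lam, compatible N k (t k) lam a &
     forall i j, (2 <= i)%N -> (2 <= j)%N -> S i j ->
       ⁅e i, e j⁆ = (if (i + j + k - 2 <= N)%N then a i j else 0) *: e (i + j + k - 2)].
Proof.
have [[i0 [j0 [i2 j2 Sij b0]]]|nex] := classic (exists i j,
  [/\ (2 <= i)%N, (2 <= j)%N, S i j & ⁅e i, e j⁆ <> 0]); last first.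
  by left=> i j i2 j2 Sij; apply: NNPP => H; apply: nex; exists i, j.
have nij : i0 <> j0 by move=> ij; apply: b0; rewrite ij liexx.
have [l cl] : exists l, co n e l ⁅e i0, e j0⁆ != 0.
  apply: NNPP => H; apply: b0; apply: (co_inj he) => l _; rewrite co0.
  by apply: NNPP => /eqP cl; apply: H; exists l.
have [lN ijl wl] := graded i2 j2 Sij cl.
pose k := (l - (i0 + j0) + 2)%N; rewrite -/k in wl.
have grk i j l' : (2 <= i)%N -> (2 <= j)%N -> S i j ->
    co n e l' ⁅e i, e j⁆ != 0 -> (l' <= N)%N /\ l' = (i + j + k - 2)%N.
  move=> i2' j2' Sij' /(graded i2' j2' Sij')[lN' ijl' /eqP].
  rewrite -wl (inj_eq (mulIf alpha0)) eqr_nat => /eqP lE; split=> //.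
  by lia.
have kN : (2 <= k)%N && (k + 3 <= N)%N by rewrite /k; lia.
pose a i j := if (i + j + k - 2 <= N)%N then co n e (i + j + k - 2)%N ⁅e i, e j⁆ else 0.
have brE i j : (2 <= i)%N -> (2 <= j)%N -> S i j ->
    ⁅e i, e j⁆ = a i j *: e (i + j + k - 2).
  move=> i2' j2' Sij'; apply: (co_inj he) => l' lP; rewrite coZ co_frame // /a.
  have [c0|cl'] := eqVneq (co n e l' ⁅e i, e j⁆) 0.
    rewrite c0; case: leqP => _; last by rewrite mul0r.
    by case: eqP => [<-|_]; rewrite ?c0 ?mul0r ?mulr0.
  have [lN' lE] := grk _ _ _ i2' j2' Sij' cl'.
  by rewrite -lE lN' eqxx mulr1.
have [|||||cmp nz] := @compatible_mktuple K N k (t k) a.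
- by move=> i; apply: tP; lia.
- by move=> i j; rewrite /a (addnC j) (lieC (e j)) coN; case: ifP; rewrite ?opprK ?oppr0.
- by move=> i; rewrite /a liexx co0 if_same.
- move=> i j i2' j2' ijN; rewrite /a !ifT; try lia.
  have -> : (i.+1 + j + k - 2 = (i + j + k - 2).+1)%N by lia.
  have -> : (i + j.+1 + k - 2 = (i + j + k - 2).+1)%N by lia.
  (* Additivity of a is ad e_1 applied to [e_i, e_j] = a i j e_(i+j+k-2). *)
  rewrite addrC -coD -(@chainN i) -?(@chainN j); try lia.
  rewrite -lie_leibniz [in RHS]brE ?SN //; try lia.
  rewrite lieZr chainN; last by lia.
  rewrite coZ co_frame ?eqxx ?mulr1 /a ?ifT //; lia.
- by move=> i j ijN; rewrite /a leqNgt ijN.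
right; exists k, [tuple a s.+2 s.+3 | s < (t k).-1], a; split=> //.
  apply/negPn/negP => /nz a0; apply: b0.
  by rewrite brE // a0 // scale0r.
move=> i j i2' j2' Sij'; rewrite brE //; case: ifP => // H.
by rewrite /a H.
Qed.

End GradedBrackets.

(** * Recognizing the listed tables *)

Section Presentations.
Variables (K : numFieldType) (L : lieAlgType K) (n : nat) (e : nat -> L).
Hypothesis he : frame n e.

Lemma presents_L : chain e ->
  (forall i j, (2 <= i)%N -> (2 <= j)%N -> ⁅e i, e j⁆ = 0) -> presents (L_table K n) e.
Proof.
move=> ce e0 i j i0 ij jn; rewrite /L_table; case: eqP => [->|i1] /=; last first.
  by rewrite comb0 e0 //; lia.
rewrite ce; last by lia.
case: ifP => jP; first by rewrite comb_basis.
by rewrite comb0 (frame_out he) //; lia.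
Qed.

Lemma presents_A k (lam : (A_t n k).-1.-tuple K) a : chain e -> (2 <= k)%N ->
  compatible n k (A_t n k) lam a ->
  (forall i j, (2 <= i)%N -> (2 <= j)%N ->
     ⁅e i, e j⁆ = (if (i + j + k - 2 <= n)%N then a i j else 0) *: e (i + j + k - 2)%N) ->
  presents (A_table n k lam a) e.
Proof.
move=> ce k2 cmp eE i j i0 ij jn; rewrite /A_table; case: eqP => [->|i1].
  rewrite ce; last by lia.
  case: ifP => jP; first by rewrite comb_basis.
  by rewrite comb0 (frame_out he) //; lia.
have i2 : (2 <= i)%N by lia.
rewrite eE //; last by lia.
case: eqP => [jE|_]; last first.
  by rewrite i2 /=; case: ifP => _; rewrite ?comb0 ?scale0r // combZ comb_basis.
have [iP|iP] := boolP (2 <= i <= A_t n k)%N; last first.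
  by rewrite comb0 ifF ?scale0r //; rewrite /A_t in iP; lia.
rewrite combZ comb_basis // -(compatible_diag cmp) // jE.
have -> : (i + i.+1 + k - 2 = 2 * i + k - 1)%N by lia.
by rewrite ifT //; rewrite /A_t in iP; lia.
Qed.

Lemma presents_B k (lam : (B_t n k).-1.-tuple K) a :
  (forall i, (2 <= i < n.-1)%N -> ⁅e 1%N, e i⁆ = e i.+1) ->
  ⁅e 1%N, e n.-1⁆ = 0 -> (forall x, ⁅x, e n⁆ = 0) ->
  (forall i, (2 <= i < n)%N -> ⁅e i, e (n.+1 - i)%N⁆ = (-1) ^+ i.+1 *: e n) ->
  (2 <= k)%N -> compatible n.-1 k (B_t n k) lam a ->
  (forall i j, (2 <= i)%N -> (2 <= j)%N -> (i + j != n.+1)%N ->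
     ⁅e i, e j⁆ = (if (i + j + k - 2 <= n.-1)%N then a i j else 0) *: e (i + j + k - 2)%N) ->
  presents (B_table n k lam a) e.
Proof.
move=> ce e1 en et k2 cmp eE i j i0 ij jn; rewrite /B_table; case: eqP => [->|i1].
  case: ifP => jP; first by rewrite comb_basis // ce //; lia.
  have [->|->] : j = n.-1 \/ j = n by lia.
    by rewrite comb0.
  by rewrite comb0.
have i2 : (2 <= i)%N by lia.
case: ifP => ijP.
  by rewrite combZ comb_basis // -et; [congr ⁅_, e _⁆; lia|lia].
rewrite eE //; try lia.
case: eqP => [jE|_]; last first.
  have [H|H] := boolP [&& 2 <= i <= n - 2, 2 <= j <= n - 2 & i + j + k - 2 <= n.-1]%N.
    by rewrite ifT ?combZ ?comb_basis //; lia.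
  by rewrite comb0 ifF ?scale0r //; lia.
have [iP|iP] := boolP (2 <= i <= B_t n k)%N; last first.
  by rewrite comb0 ifF ?scale0r //; rewrite /B_t in iP; lia.
rewrite combZ comb_basis // -(compatible_diag cmp) // jE.
have -> : (i + i.+1 + k - 2 = 2 * i + k - 1)%N by lia.
by rewrite ifT //; rewrite /B_t in iP; lia.
Qed.

End Presentations.

(** The reverse of the substitution in [completable_Q]: [e_1 - e_2, e_(n-1)] = - [e_2, e_(n-1)] =
    e_n prolongs the chain to e_n. *)
Lemma presents_Q (K : numFieldType) (L : lieAlgType K) p (e : nat -> L) (n := p.*2) :
  frame n e -> (4 <= n)%N ->
  (forall i, (2 <= i < n.-1)%N -> ⁅e 1%N, e i⁆ = e i.+1) ->
  ⁅e 1%N, e n.-1⁆ = 0 -> (forall x, ⁅x, e n⁆ = 0) ->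
  (forall i, (2 <= i < n)%N -> ⁅e i, e (n.+1 - i)%N⁆ = (-1) ^+ i.+1 *: e n) ->
  (forall i j, (2 <= i)%N -> (2 <= j)%N -> (i + j != n.+1)%N -> ⁅e i, e j⁆ = 0) ->
  exists2 e' : nat -> L, frame n e' & presents (Q_table K p) e'.
Proof.
move=> he n4 ce e1 en et e0.
pose e' i := if i == 1%N then e 1%N - e 2 else e i.
have he' : frame n e'.
  apply: (frame_triangular he) => i iP; rewrite /e'.
  - by rewrite ifF ?(frame_out he) //; lia.
  - by case: eqP => [->|_]; [apply: flag1|apply: flag_frame].
  - case: ifP => [/eqP->|_]; last by rewrite co_frame // eqxx oner_eq0.
    by rewrite coB !co_frame ?subr0 ?oner_eq0 //; lia.
exists e' => // i j i0 ij; rewrite -/n => jn; rewrite /Q_table -/n.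
have -> : e' j = e j by rewrite /e' ifF //; lia.
case: eqP => [->|i1]; last first.
  have -> : e' i = e i by rewrite /e' ifF //; lia.
  case: ifP => H.
    rewrite combZ comb_basis // {1}/e' ifF; last by lia.
    by rewrite -et; [congr ⁅_, e _⁆; lia|lia].
  by rewrite comb0; apply: e0; lia.
have [j2|j2] := eqVneq j 2%N.
  rewrite j2 /e' /= lieBl liexx subr0 ce; last by lia.
  by rewrite ifT ?comb_basis //; lia.
rewrite {1}/e' /= lieBl.
have [jn1|jn1] := eqVneq j n.-1.
  rewrite jn1 e1 sub0r ifT; last by lia.
  have := et 2%N; rewrite subSS subn1 => ->; last by lia.
  rewrite comb_basis // prednK; last by lia.
  have -> : (-1) ^+ 3 = -1 :> K by ring.
  by rewrite scaleN1r opprK /e' ifF //; lia.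
have [->|jn'] := eqVneq j n.
  by rewrite !en subr0 ifF ?comb0 //; lia.
rewrite ce ?e0 ?subr0; try lia.
rewrite ifT ?comb_basis //; try lia.
by rewrite /e' ifF //; lia.
Qed.

Lemma iso_Q (K : numFieldType) (L : lieAlgType K) n p (e : nat -> L) : n = p.*2 ->
  frame n e -> (4 <= n)%N ->
  (forall i, (2 <= i < n.-1)%N -> ⁅e 1%N, e i⁆ = e i.+1) ->
  ⁅e 1%N, e n.-1⁆ = 0 -> (forall x, ⁅x, e n⁆ = 0) ->
  (forall i, (2 <= i < n)%N -> ⁅e i, e (n.+1 - i)%N⁆ = (-1) ^+ i.+1 *: e n) ->
  (forall i j, (2 <= i)%N -> (2 <= j)%N -> (i + j != n.+1)%N -> ⁅e i, e j⁆ = 0) ->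
  L ≅ Q_alg K p.
Proof.
move=> -> he n4 ce e1 en et e0.
have [e' he' pe'] := presents_Q he n4 ce e1 en et e0.
exact: presents_iso he' pe'.
Qed.

Definition listed (K : fieldType) (L : lieAlgType K) n : Prop :=
  [\/ L ≅ L_alg K n,
      exists p, n = p.*2 /\ L ≅ Q_alg K p,
      exists k (lam : (A_t n k).-1.-tuple K) a (adm : A_admissible lam a),
        L ≅ A_alg adm |
      exists k (lam : (B_t n k).-1.-tuple K) a (adm : B_admissible lam a),
        L ≅ B_alg adm].

Lemma eigen_grading (K : fieldType) (L : lieAlgType K) n (e : nat -> L) (D : 'End(L))
    (w : nat -> K) : frame n e -> derivation D ->
  (forall i, (0 < i <= n)%N -> D (e i) = w i *: e i) ->
  (forall i x, co n e i (D x) = w i * co n e i x) /\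
  (forall i j l, co n e l ⁅e i, e j⁆ != 0 -> w l = w i + w j).
Proof.
move=> he derD De.
have coD' i x : co n e i (D x) = w i * co n e i x.
  elim/(frame_indT he): x => [|a x y Hx Hy|j jP]; first by rewrite linear0 !co0 mulr0.
    by rewrite linearP !coP Hx Hy; ring.
  rewrite De // coZ; have [->//|ij] := eqVneq i j.
  by rewrite co_frame_ne // !mulr0.
split=> // i j l cl.
have [iP|iP] := boolP (0 < i <= n)%N; last first.
  by rewrite (frame_out he iP) lie0l co0 eqxx in cl.
have [jP|jP] := boolP (0 < j <= n)%N; last first.
  by rewrite (frame_out he jP) lie0r co0 eqxx in cl.
apply: (mulIf cl); rewrite -coD' derD !De // lieZl lieZr -scalerDl coZ //.
Qed.

Lemma eigen_span (K : fieldType) (L : lieAlgType K) n (e : nat -> L) (D : 'End(L)) :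
  frame n e -> (forall i, (0 < i <= n)%N -> D (e i) = 0) -> D = 0.
Proof.
move=> he De; apply/lfunP => x; rewrite zero_lfunE.
elim/(frame_indT he): x => [|a x y Hx Hy|j jP]; first by rewrite linear0.
  by rewrite linearP /= Hx Hy scaler0 addr0.
exact: De.
Qed.

Lemma weight_shift (K : numFieldType) (alpha beta : K) i j l : (2 <= i)%N -> (2 <= j)%N -> (i + j <= l)%N ->
  beta + (l - 2)%:R * alpha = beta + (i - 2)%:R * alpha + (beta + (j - 2)%:R * alpha) ->
  (l - (i + j) + 2)%:R * alpha = beta.
Proof.
move=> i2 j2 ijl H.
have -> : (l - (i + j) + 2)%:R = (l - 2)%:R - (i - 2)%:R - (j - 2)%:R :> K.
  have -> : (l - 2 = (l - (i + j) + 2) + (i - 2) + (j - 2))%N by lia.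
  by rewrite !natrD; ring.
move/eqP: H; rewrite -subr_eq0 => /eqP H.
by apply/eqP; rewrite -subr_eq0 -[X in _ == X]H; apply/eqP; ring.
Qed.

(** * Chains of eigenvectors and the case delta = 0 *)

Section EigenChain.
Variables (K : numFieldType) (L : lieAlgType K) (n : nat) (e : nat -> L).
Hypothesis ae : adapted n e.
Variables (Y1 Y2 : L).
Hypothesis Y2F : flag n e 2 Y2.

Let he := adapted_frame ae.



Local Notation Co := (co n e).
Local Notation F := (flag n e).
Local Notation delta := (Co n ⁅e 2, e n.-1⁆).

Definition eigen_chain i :=
  match i with 0 => 0 | 1 => Y1 | i.+2 => iter i (lie Y1) Y2 end.

Local Notation y := eigen_chain.

Lemma eigen_chainS i : (2 <= i)%N -> y i.+1 = ⁅Y1, y i⁆.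
Proof. by case: i => [|[]]. Qed.

Lemma eigen_chain_flag i : (2 <= i)%N -> F i (y i).
Proof.
elim: i => // i IH; rewrite ltnS leq_eqVlt => /orP[/eqP<-//|i2].
by rewrite eigen_chainS //; apply: (adapted_lieS ae) => //; apply: IH.
Qed.

Hypothesis n5 : (5 <= n)%N.

Lemma eigen_chain_out i : ~~ (0 < i <= n)%N -> y i = 0.
Proof.
have [->//|i0] := posnP i; move=> iP; have := @eigen_chain_flag i.
by move=> H; apply: (flag_gt he _ (H _)); lia.
Qed.

(** Modulo F_2, Y1 is a multiple of e_1, and [F_2, F_i] lies in F_(i+2) except possibly at i = n -
    1, where delta intervenes. *)
Lemma co_eigen_chainS i : (2 <= i < n)%N -> (i + 2 <= n)%N \/ delta = 0 ->
  Co i.+1 (y i.+1) = Co 1 Y1 * Co i (y i).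
Proof.
move=> iP iD; rewrite eigen_chainS; last by lia.
have Ft : F 2 (Y1 - Co 1 Y1 *: e 1%N) by apply: (flag_tail he); apply: flag1.
rewrite -{1}(subrK (Co 1 Y1 *: e 1%N) Y1) lieDl coD lieZl coZ (co_ad1 ae) //.
have Fi : F i (y i) by apply: eigen_chain_flag; lia.
have := adapted_lie_gt ae (i := 2) (j := i) isT _ _ _ Ft Fi.
by rewrite add2n => H; rewrite H ?add0r //; try lia; rewrite addnC in iD; case: iD; auto.
Qed.

Hypotheses (Y1n : Co 1 Y1 != 0) (Y2n : Co 2 Y2 != 0).

Lemma eigen_chain_neq0 i : (1 <= i <= n)%N -> (i < n)%N \/ delta = 0 -> Co i (y i) != 0.
Proof.
elim: i => // i IH iP iD; have [i0|i0] := posnP i; first by rewrite i0.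
have [i1|i1] := eqVneq i 1%N; first by rewrite i1.
rewrite co_eigen_chainS; try lia; last by case: iD; [left; lia|right].
by rewrite mulf_neq0 // IH; [|lia|case: iD; [left; lia|right]].
Qed.

Variables (D : 'End(L)) (alpha beta : K).
Hypothesis derD : derivation D.
Hypotheses (DY1 : D Y1 = alpha *: Y1) (DY2 : D Y2 = beta *: Y2).

Lemma eigen_chain_eigen i : (2 <= i)%N -> D (y i) = (beta + (i - 2)%:R * alpha) *: y i.
Proof.
elim: i => // i IH; rewrite ltnS leq_eqVlt => /orP[/eqP<-|i2].
  by rewrite mul0r addr0.
rewrite eigen_chainS // derD DY1 IH // lieZl lieZr -scalerDl; congr (_ *: _).
by rewrite (subSn i2) -natr1; ring.
Qed.

Hypothesis D0 : D != 0.

Lemma listed_of_delta0 : delta = 0 -> listed L n.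
Proof.
move=> d0.
have hy : frame n y.
  apply: (frame_triangular he) => i iP.
  - exact: eigen_chain_out.
  - by case: i iP => [|[|i]] // _; [apply: flag1|apply: eigen_chain_flag].
  - by apply: eigen_chain_neq0; [|right].
have cy : chain y by move=> i i2; rewrite eigen_chainS.
pose w i := if i == 1%N then alpha else beta + (i - 2)%:R * alpha.
have Dy i : (0 < i <= n)%N -> D (y i) = w i *: y i.
  by rewrite /w; case: eqP => [->//|i1 iP]; rewrite eigen_chain_eigen //; lia.
have [_ gr] := eigen_grading hy derD Dy.
have yF i j : (2 <= i)%N -> (2 <= j)%N -> flag n y (i + j) ⁅y i, y j⁆.
  move=> i2 j2; apply: (flag_triangular_inv he).
  - exact: eigen_chain_out.
  - by case=> [|[|i']] // _; [apply: flag1|apply: eigen_chain_flag].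
  - by move=> *; apply: eigen_chain_neq0; [|right].
  by apply: (adapted_lie_gt ae) => //; [lia|right|apply: eigen_chain_flag..].
have ge i j l : (2 <= i)%N -> (2 <= j)%N -> co n y l ⁅y i, y j⁆ != 0 ->
    [/\ (l <= n)%N, (i + j <= l)%N &
      beta + (l - 2)%:R * alpha = beta + (i - 2)%:R * alpha + (beta + (j - 2)%:R * alpha)].
  move=> i2 j2 cl.
  have ijl : (i + j <= l)%N by rewrite leqNgt; apply: contraNN cl => lij; rewrite yF.
  split=> //; first by rewrite leqNgt; apply: contraNN cl => ln; rewrite co_out //; lia.
  by have := gr _ _ _ cl; rewrite /w !ifF //; lia.
have toL : (forall i j, (2 <= i)%N -> (2 <= j)%N -> ⁅y i, y j⁆ = 0) -> listed L n.
  by move=> y0; constructor 1; apply: (presents_iso _ hy); apply: presents_L.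
(* If alpha = 0, all y_i with i >= 2 have weight beta <> 0, and their brackets, of weight 2 beta,
   find no target. *)
have [a0|a0] := eqVneq alpha 0.
  have b0 : beta != 0.
    apply: contra_neq D0 => b0; apply: (eigen_span hy) => i iP.
    by rewrite Dy // /w a0 b0 mulr0 addr0 if_same scale0r.
  apply: toL => i j i2 j2; apply: (co_inj hy) => l _; rewrite co0.
  apply/eqP/negPn/negP => /(ge _ _ _ i2 j2)[_ _].
  rewrite a0 !mulr0 !addr0 => /eqP; rewrite -subr_eq0 opprD addrA subrr add0r oppr_eq0.
  by apply/negP.
have [||||||y0|[k [lam [a [/andP[k2 kn] nz cmp br]]]]] :=
    @graded_brackets K L n n y (fun _ _ => true) alpha beta (fun k => A_t n k) hy.
- by [].
- by move=> i /andP[i2 _]; apply: cy.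
- by [].
- by [].
- by move=> i j l i2 j2 _ /(ge _ _ _ i2 j2)[ln ijl H]; split=> //; apply: weight_shift H.
- by move=> k i k2; rewrite /A_t; lia.
- by apply: toL => i j i2 j2; apply: y0.
have pr : presents (A_table n k lam a) y.
  by apply: presents_A => // i j i2 j2; apply: br.
constructor 3; exists k, lam, a.
have adm : A_admissible lam a.
  by split=> //; [rewrite k2|apply: presents_jacobi pr].
by exists adm; apply: presents_iso pr.
Qed.

End EigenChain.

(** The only bracket away from e_1 that the flags allow is [e_2, e_3] in F_4, removed by the choice
    of e_2. Larger n relies on the invariance of F_2, proved for n >= 5. *)
Lemma listed_small (K : numFieldType) (L : lieAlgType K) n (e : nat -> L) :
  adapted n e -> (n <= 4)%N -> listed L n.
Proof.
move=> ae n4; have he := adapted_frame ae.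
constructor 1; apply: (presents_iso _ he); apply: presents_L => //.
  exact: (adapted_chain ae).
have lt i j : (2 <= i)%N -> (i < j)%N -> ⁅e i, e j⁆ = 0.
  move=> i2 ij; have Fij : flag n e (i + j - 1) ⁅e i, e j⁆.
    by apply: (adapted_lieD ae) => //; try exact: flag_frame; lia.
  have [ij5|ij5] := ltnP 5 (i + j); first by apply: (flag_gt he _ Fij); lia.
  have [iE jE] : i = 2%N /\ j = 3%N by lia.
  rewrite iE jE in Fij *; apply: (flag_gt he (m := 5)) => //.
  by apply: flagS => //; apply: (adapted_e23 ae).
move=> i j i2 j2; have [ij|ji|->] := ltngtP i j; last exact: liexx.
  exact: lt.
by rewrite lieC lt // oppr0.
Qed.

(** * The case of nonzero delta *)

Section NonzeroDelta.
Variables (K : numFieldType) (L : lieAlgType K) (n : nat) (e : nat -> L).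
Hypotheses (ae : adapted n e) (n5 : (5 <= n)%N).
Local Notation Co := (co n e).
Local Notation F := (flag n e).
Local Notation delta := (Co n ⁅e 2, e n.-1⁆).
Variables (D : 'End(L)) (Y1 Y2 : L) (alpha beta : K).
Hypotheses (derD : derivation D).
Hypotheses (DY1 : D Y1 = alpha *: Y1) (DY2 : D Y2 = beta *: Y2).
Hypothesis Y2F : F 2 Y2.
Hypothesis Y1c : Co 1 Y1 + Co 2 Y1 * delta = 0.

Let he := adapted_frame ae.

Local Notation y := (eigen_chain Y1 Y2).

(** [Y1, y_(n-1)] = 0, so the top vector comes from the pairing; the sign matches (-1)^(i+1) at i =
    2. *)
Definition eigen_basis i := if i == n then - ⁅Y2, y n.-1⁆ else y i.

Local Notation z := eigen_basis.

Definition eigen_weight i :=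
  if i == n then beta + (beta + (n - 3)%:R * alpha)
  else if i == 1%N then alpha else beta + (i - 2)%:R * alpha.

Let zE i : i != n -> z i = y i. Proof. by rewrite /eigen_basis => /negPf->. Qed.

Lemma eigen_basis_flag i : (1 <= i)%N -> F i (z i).
Proof.
have [->|i1] := eqVneq i 1%N; first by move=> _; apply: flag1.
move=> i0; rewrite /eigen_basis; case: eqP => [->|_]; last first.
  by apply: (eigen_chain_flag ae) => //; lia.
apply: flagN; have E : (2 + n.-1 - 1 = n)%N by lia.
rewrite -[X in flag _ _ X _]E.
by apply: (adapted_lieD ae) => //; [lia|apply: (eigen_chain_flag ae)=> //; lia].
Qed.

Lemma eigen_basis_out i : ~~ (0 < i <= n)%N -> z i = 0.
Proof.
move=> iP; rewrite zE; last by apply: contraNneq iP => ->; lia.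
exact: (eigen_chain_out ae).
Qed.

Lemma eigen_basis_eigen i : (0 < i <= n)%N -> D (z i) = eigen_weight i *: z i.
Proof.
move=> iP; rewrite /eigen_weight /eigen_basis.
case: eqP => [iE|_]; last first.
  by case: eqP => [->//|i1]; rewrite (eigen_chain_eigen derD DY1 DY2) //; lia.
rewrite linearN /= derD DY2 (eigen_chain_eigen derD DY1 DY2); last by lia.
rewrite lieZl lieZr -scalerDl scalerN; congr (- (_ *: _)).
by have -> : (n.-1 - 2 = n - 3)%N by lia.
Qed.

Lemma eigen_basis_central x : ⁅x, z n⁆ = 0.
Proof.
apply: (flag_gt he (leqnn _)); apply: (adapted_lieS ae); first by lia.
by apply: eigen_basis_flag; lia.
Qed.

Lemma eigen_basis_chain i : (2 <= i < n.-1)%N -> ⁅z 1%N, z i⁆ = z i.+1.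
Proof.
move=> iP; rewrite !zE; try lia.
by rewrite (@eigen_chainS _ _ Y1 Y2 i) //; lia.
Qed.

Lemma eigen_basis_chain_end : ⁅z 1%N, z n.-1⁆ = 0.
Proof.
rewrite !zE; try lia.
have Fy : F n.-1 (y n.-1) by apply: (eigen_chain_flag ae) => //; lia.
have := flag_tail he Fy; rewrite prednK => [Ft|]; last by lia.
rewrite -(subrK (Co n.-1 (y n.-1) *: e n.-1) (y n.-1)) lieDr lieZr.
have -> : ⁅Y1, y n.-1 - Co n.-1 (y n.-1) *: e n.-1⁆ = 0.
  by apply: (flag_gt he (leqnn _)); apply: (adapted_lieS ae) => //; lia.
have -> : ⁅Y1, e n.-1⁆ = 0; last by rewrite scaler0 addr0.
apply: (flag_gt he (leqnn _)); apply: flagS.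
  rewrite -[X in flag _ _ X _](@prednK n); last by lia.
  by apply: (adapted_lieS ae); [lia|apply: flag_frame].
by rewrite (co_lie_pred ae) //; lia.
Qed.

(** [z_i, z_(n-i)] lies in F_n, so ad z_1 kills it, and the Leibniz rule gives a change of sign from
    i to i + 1. *)
Lemma eigen_basis_pairing i : (2 <= i < n)%N ->
  ⁅z i, z (n.+1 - i)%N⁆ = (-1) ^+ i.+1 *: z n.
Proof.
have -> : z n = - ⁅Y2, y n.-1⁆ by rewrite /eigen_basis eqxx.
elim: i => // i IH iP; have [i1|i1] := eqVneq i 1%N.
  rewrite i1 subSS subn1 !zE; try lia.
  have -> : (-1) ^+ 3 = -1 :> K by ring.
  by rewrite scaleN1r opprK.
have := lie_leibniz (z 1%N) (z i) (z (n - i)%N).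
rewrite eigen_basis_chain; last by lia.
rewrite eigen_basis_chain; last by lia.
have -> : ⁅z 1%N, ⁅z i, z (n - i)%N⁆⁆ = 0.
  apply: (flag_gt he (leqnn _)); apply: (adapted_lieS ae); first by lia.
  have E : (i + (n - i) = n)%N by lia.
  rewrite -[X in flag _ _ X _]E.
  apply: (adapted_lie_gt ae); try lia.
    by apply: eigen_basis_flag; lia.
  by apply: eigen_basis_flag; lia.
have -> : ((n - i).+1 = n.+1 - i)%N by lia.
rewrite IH; last by lia.
move/esym/eqP; rewrite addr_eq0 subSS => /eqP->.
by rewrite [in RHS]exprS mulN1r scaleNr.
Qed.

Hypothesis delta0 : delta != 0.

Lemma delta_even : ~~ odd n.
Proof. by apply: contraNN delta0 => no; rewrite (lie_top_odd ae) //; lia. Qed.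

Let n6 : (6 <= n)%N.
Proof. by have := delta_even; lia. Qed.

Hypotheses (Y1n : Co 1 Y1 != 0) (Y2n : Co 2 Y2 != 0).

Lemma eigen_basis_neq0 i : (0 < i <= n)%N -> Co i (z i) != 0.
Proof.
move=> iP; have [iE|iN] := eqVneq i n; last first.
  by rewrite zE //; apply: (eigen_chain_neq0 ae) => //; left; lia.
rewrite iE /eigen_basis eqxx coN oppr_eq0.
have Fy : F n.-1 (y n.-1) by apply: (eigen_chain_flag ae) => //; lia.
have Ft := flag_tail he Y2F.
rewrite -{1}(subrK (Co 2 Y2 *: e 2) Y2) lieDl coD lieZl coZ.
rewrite (adapted_lieD ae (i := 3) (j := n.-1) _ _ Ft Fy) ?add0r //; try lia.
have E : (2 + n.-1 - 1 = n)%N by lia.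
rewrite -[X in _ * co _ _ X _]E (co_lie_flag ae) //; last by lia.
rewrite E.
by rewrite !mulf_neq0 // (eigen_chain_neq0 ae) //; [lia|left; lia].
Qed.

Lemma eigen_basis_frame : frame n z.
Proof.
apply: (frame_triangular he) => i iP.
- exact: eigen_basis_out.
- by apply: eigen_basis_flag; lia.
- exact: eigen_basis_neq0.
Qed.

Let hz := eigen_basis_frame.

Lemma eigen_basis_bracket i j l : (2 <= i)%N -> (2 <= j)%N -> (i + j != n.+1)%N ->
  co n z l ⁅z i, z j⁆ != 0 ->
  [/\ (i < n)%N, (j < n)%N, (i + j <= l)%N, (l <= n)%N &
   eigen_weight l = beta + (i - 2)%:R * alpha + (beta + (j - 2)%:R * alpha)].
Proof.
move=> i2 j2 ijn cl.
have z0 u : (n <= u)%N -> forall x, ⁅x, z u⁆ = 0.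
  rewrite leq_eqVlt => /orP[/eqP<- x|nu x]; first exact: eigen_basis_central.
  by rewrite eigen_basis_out ?lie0r //; lia.
have iP : (i < n)%N.
  by rewrite ltnNge; apply: contraNN cl => ni; rewrite lieC z0 // oppr0 co0.
have jP : (j < n)%N.
  by rewrite ltnNge; apply: contraNN cl => nj; rewrite z0 // co0.
have Fi : F i (z i) by apply: eigen_basis_flag; lia.
have Fj : F j (z j) by apply: eigen_basis_flag; lia.
have ijn' : (i + j <= n)%N.
  rewrite leqNgt; apply: contraNN cl => nij.
  rewrite (_ : ⁅z i, z j⁆ = 0) ?co0 //.
  apply: (flag_gt he (m := i + j - 1)); first by lia.
  exact: (adapted_lieD ae).
have Fl : flag n z (i + j) ⁅z i, z j⁆.
  apply: (flag_triangular_inv he) => [u uP|u uP|u uP|].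
  - exact: eigen_basis_out.
  - by apply: eigen_basis_flag; lia.
  - exact: eigen_basis_neq0.
  - by apply: (adapted_lie_gt ae) => //; [lia|left].
split=> //.
- by rewrite leqNgt; apply: contraNN cl => H; rewrite Fl.
- by rewrite leqNgt; apply: contraNN cl => H; rewrite co_out //; lia.
have [_ gr] := eigen_grading hz derD eigen_basis_eigen.
by rewrite (gr _ _ _ cl) /eigen_weight !ifF //; lia.
Qed.

Hypothesis D0 : D != 0.

Lemma listed_of_alpha : alpha != 0 -> listed L n.
Proof.
move=> a0.
have [|||||| y0|[k [lam [a [/andP[k2 kn] nz cmp br]]]]] :=
    @graded_brackets K L n n.-1 z (fun i j => i + j != n.+1)%N alpha beta (fun k => B_t n k) hz.
- exact: leq_pred.
- exact: eigen_basis_chain.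
- by move=> i j ijn; lia.
- by [].
- move=> i j l i2 j2 ijn cl; have [iP jP ijl ln wl] := eigen_basis_bracket i2 j2 ijn cl.
  (* The weights 2 beta + (n - 3) alpha of z_n and 2 beta + (i + j - 4) alpha of [z_i, z_j] agree
     only for i + j = n + 1. *)
  have lN : l != n.
    apply: contraNneq ijn => lE; move: wl; rewrite lE /eigen_weight eqxx.
    move/eqP; rewrite -subr_eq0 => /eqP w0.
    have /eqP : ((n - 3)%:R - (i - 2)%:R - (j - 2)%:R) * alpha = 0.
      by rewrite -[RHS]w0; ring.
    rewrite mulf_eq0 (negPf a0) orbF -addrA -opprD -natrD subr_eq0 eqr_nat; lia.
  split=> //; first by lia.
  apply: weight_shift => //; rewrite -wl /eigen_weight !ifF //; lia.
- by move=> k i k2; rewrite /B_t; lia.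
- constructor 2; exists n./2; have nE : n = n./2.*2 by have := delta_even; lia.
  split=> //; apply: (iso_Q nE hz); first by lia.
  - exact: eigen_basis_chain.
  - exact: eigen_basis_chain_end.
  - exact: eigen_basis_central.
  - exact: eigen_basis_pairing.
  - exact: y0.
have pr : presents (B_table n k lam a) z.
  apply: (presents_B hz) => //.
  - exact: eigen_basis_chain.
  - exact: eigen_basis_chain_end.
  - exact: eigen_basis_central.
  - exact: eigen_basis_pairing.
constructor 4; exists k, lam, a.
have adm : B_admissible lam a.
  split=> //; [exact: delta_even|lia|exact: presents_jacobi hz pr].
by exists adm; apply: presents_iso hz pr.
Qed.

End NonzeroDelta.

(* When every element of the torus kills Y_1, the cube of ad Y_1, extended by 0
   to the torus, is a derivation which is not inner. *)
Section DegenerateTorus.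
Variables (K : numFieldType) (L : lieAlgType K) (n : nat) (e : nat -> L).
Hypotheses (ae : adapted n e) (n5 : (5 <= n)%N).
Local Notation Co := (co n e).
Local Notation F := (flag n e).
Local Notation delta := (Co n ⁅e 2, e n.-1⁆).
Hypothesis delta0 : delta != 0.
Variable t : torus L.
Hypothesis t0 : forall h Y a, h \in (t : {vspace 'End(L)}) ->
  Co 1 Y + Co 2 Y * delta = 0 -> Co 1 Y != 0 -> h Y = a *: Y -> a = 0.
Variables (D : 'End(L)) (Y1 Y2 : L) (beta : K).
Hypotheses (Dt : D \in (t : {vspace 'End(L)})) (D0 : D != 0).
Hypotheses (DY1 : D Y1 = 0 *: Y1) (DY2 : D Y2 = beta *: Y2).
Hypotheses (Y1n : Co 1 Y1 != 0) (Y2F : F 2 Y2) (Y2n : Co 2 Y2 != 0).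
Hypothesis Y1c : Co 1 Y1 + Co 2 Y1 * delta = 0.

Let he := adapted_frame ae.
Let der h (ht : h \in (t : {vspace 'End(L)})) : derivation h.
Proof. by case: (torusP t) => H _ _; apply: H. Qed.

Let z := eigen_basis n Y1 Y2.
Let hz : frame n z := eigen_basis_frame ae n5 Y2F delta0 Y1n Y2n.
Let Dz := eigen_basis_eigen n5 (der Dt) DY1 DY2.
Let w := eigen_weight n 0 beta.

Let n6 : (6 <= n)%N.
Proof. by have := delta_even ae n5 delta0; lia. Qed.

Let wE i : w i = if i == n then beta + beta else if i == 1%N then 0 else beta.
Proof. by rewrite /w /eigen_weight !mulr0 !addr0. Qed.

Let beta0 : beta != 0.
Proof.
apply: contra_neq D0 => b0; apply: (eigen_span hz) => i iP.
by rewrite Dz // -/w wE b0 addr0 !if_same scale0r.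
Qed.

Let w_neq0 i : (2 <= i)%N -> w i != 0.
Proof.
move=> i2; rewrite wE (_ : (i == 1%N) = false); last by lia.
by case: ifP => // _; rewrite -mulr2n mulrn_eq0.
Qed.

Let z1 : z 1%N = Y1.
Proof. by rewrite /z /eigen_basis ifF //; lia. Qed.

Let kerD x : D x = 0 -> x = co n z 1 x *: z 1%N.
Proof.
move=> Dx; have [coD' _] := eigen_grading hz (der Dt) Dz.
apply: (co_inj hz) => i iP; rewrite coZ co_frame //.
have [->|i1] := eqVneq i 1%N; first by rewrite mulr1.
rewrite mulr0; apply: (mulfI (w_neq0 (i := i) _)); first by lia.
by rewrite -coD' Dx co0 mulr0.
Qed.

(** h preserves the kernel of D, which is the line of z_1, and [t0] says that its eigenvalue there
    is 0. *)
Let torus_z1 h : h \in (t : {vspace 'End(L)}) -> h (z 1%N) = 0.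
Proof.
move=> ht; have [_ _ com] := torusP t.
have hE : h (z 1%N) = co n z 1 (h (z 1%N)) *: z 1%N.
  by apply: kerD; rewrite -comp_lfunE (com _ _ Dt ht) comp_lfunE z1 DY1 scale0r linear0.
have := t0 ht Y1c Y1n; rewrite -z1 => /(_ _ hE) c0.
by rewrite hE c0 scale0r.
Qed.

Local Notation N := (lie (z 1%N)).

Let zF i : (1 <= i)%N -> F i (z i).
Proof. exact: eigen_basis_flag. Qed.

Let flag_z m x : F m x -> flag n z m x.
Proof.
apply: (flag_triangular_inv he) => [u uP|u uP|u uP].
- exact: (eigen_basis_out ae n5).
- by apply: zF; lia.
- exact: (eigen_basis_neq0 ae n5).
Qed.

(** [z_i, z_j] has weight 2 beta, which z_n alone carries; pairs with i + j = n + 1 are in F_n by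
    degree. *)
Let lie_F2 u v : F 2 u -> F 2 v -> F n ⁅u, v⁆.
Proof.
move=> Fu Fv.
have basis i j : (2 <= i)%N -> (2 <= j)%N -> F n ⁅z i, z j⁆.
  move=> i2 j2; have [ijn|ijn] := eqVneq (i + j)%N n.+1.
    have E : (i + j - 1 = n)%N by lia.
    rewrite -[X in flag _ _ X _]E.
    by apply: (adapted_lieD ae) => //; apply: zF; lia.
  suff -> : ⁅z i, z j⁆ = co n z n ⁅z i, z j⁆ *: z n by apply: flagZ; apply: zF; lia.
  apply: (co_inj hz) => l lP; rewrite coZ co_frame //.
  have [->|ln] := eqVneq l n; first by rewrite mulr1.
  rewrite mulr0; apply/eqP/negPn/negP => cl.
  have [iP jP ijl _] := eigen_basis_bracket ae n5 (der Dt) DY1 DY2 Y2F delta0 Y1n Y2n i2 j2 ijn cl.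
  rewrite -/w wE (negPf ln) !mulr0 !addr0; case: eqP => [l1|_]; first by lia.
  move/eqP; rewrite -subr_eq0 opprD addrA subrr add0r oppr_eq0.
  by apply/negP.
move/flag_z: Fu; move/flag_z: Fv => Fv Fu.
apply: (@frame_ind _ _ _ _ hz (fun u => F n ⁅u, v⁆) _ _ 2 _ u Fu).
- by rewrite lie0l; apply: flag0.
- by move=> a x y Hx Hy; rewrite lieDl lieZl; apply: flagL.
move=> i i2 _; apply: (@frame_ind _ _ _ _ hz (fun v => F n ⁅z i, v⁆) _ _ 2 _ v Fv).
- by rewrite lie0r; apply: flag0.
- by move=> a x y Hx Hy; rewrite lieDr lieZr; apply: flagL.
by move=> j j2 _; apply: basis.
Qed.

Let N_F m x : (2 <= m)%N -> F m x -> F m.+1 (N x).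
Proof. exact: (adapted_lieS ae). Qed.

Let N_skew u v : F 2 u -> F 2 v -> ⁅N u, v⁆ = - ⁅u, N v⁆.
Proof.
move=> Fu Fv; apply/eqP; rewrite -addr_eq0 -lie_leibniz; apply/eqP.
apply: (flag_gt he (leqnn _)); apply: N_F; [lia|exact: lie_F2].
Qed.

Let N_F2 x : F 2 x -> F 2 (N x).
Proof. by move=> Fx; apply: flag_le (N_F _ Fx). Qed.

Let f : 'End(L) := (ad (z 1%N) \o ad (z 1%N) \o ad (z 1%N))%VF.

Let fE x : f x = N (N (N x)).
Proof. by rewrite /f !comp_lfunE !lfunE. Qed.

(** On F_2 three uses of [N_skew] move N^3 across the bracket with sign -1, while N kills
    [F_2, F_2]. Against z_1 it suffices that f commutes with N and kills z_1. *)
Let der_f : derivation f.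
Proof.
apply: (derivation_frame hz) => i j i0 ij jn; rewrite !fE.
have [->|i1] := eqVneq i 1%N; first by rewrite liexx !lie0r lie0l add0r.
have Fi : F 2 (z i) by apply: flag_le (zF _); lia.
have Fj : F 2 (z j) by apply: flag_le (zF _); lia.
have -> : N ⁅z i, z j⁆ = 0.
  by apply: (flag_gt he (leqnn _)); apply: N_F; [lia|exact: lie_F2].
rewrite !lie0r N_skew; [|by do 2!apply: N_F2|by []].
rewrite N_skew ?opprK; [|by apply: N_F2|by apply: N_F2].
by rewrite N_skew ?addNr //; do 2!apply: N_F2.
Qed.

Let f_comm h x : h \in (t : {vspace 'End(L)}) -> h (f x) = f (h x).
Proof.
move=> ht; have NC u : h (N u) = N (h u) by rewrite (der ht) torus_z1 // lie0l add0r.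
by rewrite !fE !NC.
Qed.

Lemma degenerate_not_complete : ~ complete (semidirect t).
Proof.
case=> _ inner.
pose g (x : semidirect t) : semidirect t := (f x.1, 0).
have gL : linear g.
  move=> a x y; rewrite /g [RHS]surjective_pairing; congr pair => /=.
    by rewrite linearP.
  by rewrite scaler0 addr0.
pose gl := GRing.isLinear.Build K (semidirect t) (semidirect t) *:%R g gL.
pose G : {linear semidirect t -> semidirect t} := HB.pack g gl.
have sE (x y : semidirect t) :
  ⁅x, y⁆ = (⁅x.1, y.1⁆ + vsval x.2 y.1 - vsval y.2 x.1, 0) by [].
have GE x : linfun G x = (f x.1, 0) by rewrite lfunE.
have [|[a h] aE] := inner (linfun G).
  move=> x y; rewrite !GE !sE [RHS]surjective_pairing /= !addr0; congr pair.
  rewrite linearB linearD /= der_f !zero_lfunE addr0 subr0.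
  have fh (u : subvs_of t) v : vsval u (f v) = f (vsval u v) by apply/f_comm/subvsP.
  by rewrite !fh -!addrA; congr (_ + _); rewrite addrA addrC.
have adE x : (f x.1, 0) = ⁅(a, h) : semidirect t, x⁆ by rewrite -GE aE lfunE.
(* The derivation is 0 on the torus, so (a, h) commutes with D; a is thus on the line of z_1, and f
   = c N + h on [L]. *)
have Da : D a = 0.
  have := congr1 fst (adE (0, Subvs Dt)); rewrite sE /= !(lie0r, linear0, add0r).
  by move/esym/eqP; rewrite oppr_eq0 => /eqP.
have hE x : f x = co n z 1 a *: N x + vsval h x.
  have := congr1 fst (adE (x, 0)); rewrite sE /= zero_lfunE subr0 => ->.
  by rewrite {1}(kerD Da) lieZl.
have ht := subvsP h; set h' := vsval h in hE ht.
have hF m x : (2 <= m)%N -> F m x -> F m.+1 (h' x).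
  move=> m2 Fx; have -> : h' x = f x - co n z 1 a *: N x by rewrite hE addrAC subrr add0r.
  apply: flagB; last by apply: flagZ; apply: N_F.
  rewrite fE; apply: flag_le (N_F _ (N_F _ (N_F _ Fx))); lia.
(* Like f and N, h' raises the flags from F_2 on, so it is nilpotent there; being diagonalizable as
   well, it kills z_2. *)
have h2 : h' (z 2%N) = 0.
  apply: NNPP => hz2.
  have [_ diag _] := torusP t.
  have [||||y [b [Fy hy yb]]] := @exists_eigenvector K L h' (F 2) (fun x => h' x = 0)
    (diag _ ht) (subspace_flag _ _ _) _ _ _ (z 2%N) _ hz2.
  - by move=> x Fx; apply: flag_le (hF _ _ _ Fx).
  - by split; [rewrite linear0|move=> c x y Hx Hy; rewrite linearP /= Hx Hy scaler0 addr0].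
  - by move=> x Hx; rewrite Hx linear0.
  - exact: zF.
  have b0 : b != 0 by apply/eqP => b0; apply: hy; rewrite yb b0 scale0r.
  have Fm m : F m.+2 y.
    elim: m => // m IH; rewrite -[y](scalerK b0) -yb; apply: flagZ; exact: hF.
  by apply: hy; rewrite (flag_gt he _ (Fm n)) ?linear0 //; lia.
have zc i : (2 <= i < 5)%N -> N (z i) = z i.+1.
  by move=> iP; apply: (eigen_basis_chain); lia.
(* On z_2 the identity reads z_5 = c z_3; n >= 6 ensures that the chain reaches z_5. *)
have := hE (z 2%N); rewrite h2 addr0 fE !zc // => /(congr1 (co n z 5)).
rewrite coZ (co_frame_ne hz (j := 3%N)) // co_frame // mulr0 => /eqP.
by rewrite eqxx oner_eq0.
Qed.

End DegenerateTorus.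

(** * Existence of Y_1 and Y_2, and the two implications *)

Section ExistsEigenvectors.
Variables (K : numFieldType) (L : lieAlgType K) (n : nat) (e : nat -> L).
Hypotheses (ae : adapted n e) (n5 : (5 <= n)%N).
Local Notation Co := (co n e).
Local Notation F := (flag n e).
Local Notation delta := (Co n ⁅e 2, e n.-1⁆).
Variable D : 'End(L).
Hypotheses (derD : derivation D) (diagD : diagonalizable_end D).

Let he := adapted_frame ae.

Lemma exists_eigenvector_flag2 : exists Y beta,
  [/\ F 2 Y, Co 2 Y != 0 & D Y = beta *: Y].
Proof.
have [||||y [b [Fy nFy yb]]] := exists_eigenvector diagD (subspace_flag n e 2) _
    (subspace_flag n e 3) _ (x := e 2) _ _.
- exact: (derivation_flag2 ae).
- exact: (derivation_flag ae).
- exact: (flag_frame he).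
- move=> /(_ 2%N isT); rewrite (co_frame he) ?eqxx; last by lia.
  by move/eqP; rewrite oner_eq0.
by exists y, b; split=> //; apply/eqP => y2; apply: nFy; apply: flagS.
Qed.

Lemma exists_eigenvector_top : exists Y alpha, Co 1 Y != 0 /\ D Y = alpha *: Y.
Proof.
have [||||y [b [_ nFy yb]]] := @exists_eigenvector _ _ _ (fun=> True) (F 2) diagD _ _
    (subspace_flag n e 2) _ (e 1%N) I _.
- by [].
- by [].
- exact: (derivation_flag2 ae).
- move=> /(_ 1%N isT); rewrite (co_frame he) ?eqxx; last by lia.
  by move/eqP; rewrite oner_eq0.
exists y, b; split=> //; apply/eqP => y1; apply: nFy; apply: flagS => //; exact: flag1.
Qed.

Lemma exists_eigenvector_centralizer : delta != 0 -> exists Y alpha,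
  [/\ Co 1 Y != 0, Co 1 Y + Co 2 Y * delta = 0 & D Y = alpha *: Y].
Proof.
move=> d0; pose U x := Co 1 x + Co 2 x * delta = 0.
(* delta e_1 - e_2 satisfies the equation of the centralizer and, as delta <> 0, is not in F_2. *)
have [|||||y [b [Uy nFy yb]]] := @exists_eigenvector _ _ _ U (F 2) diagD _ _
    (subspace_flag n e 2) _ (delta *: e 1%N - e 2) _ _.
- split; first by rewrite /U !co0 mul0r addr0.
  rewrite /U => a x y Hx Hy; rewrite !coP.
  by rewrite mulrDl addrACA -mulrA -mulrDr Hx Hy mulr0 addr0.
- exact: (derivation_centralizer ae).
- exact: (derivation_flag2 ae).
- by rewrite /U !coB !coZ !(co_frame he) //=; try lia; ring.
- move=> /(_ 1%N isT); rewrite coB coZ !(co_frame he) //=; try lia.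
  by rewrite mulr1 subr0 => /eqP; apply/negP.
exists y, b; split=> //; apply/eqP => y1; apply: nFy; apply: flagS => //; exact: flag1.
Qed.

End ExistsEigenvectors.

(** With a zero torus, e_n would be central in the semidirect product. *)
Lemma complete_torus_neq0 (K : numFieldType) (L : lieAlgType K) n (e : nat -> L) (t : torus L) :
  adapted n e -> (2 <= n)%N -> complete (semidirect t) ->
  exists2 D, D \in (t : {vspace 'End(L)}) & D != 0.
Proof.
move=> ae n2 [cen _]; have he := adapted_frame ae; apply: NNPP => H.
have t0 (h : subvs_of t) : vsval h = 0.
  by apply: NNPP => /eqP h0; apply: H; exists (vsval h); first exact: subvsP.
have nP : (0 < n <= n)%N by lia.
case/negP: (frame_neq0 he nP); apply/eqP.
suff H0 : (e n, 0) = 0 :> semidirect t by have := congr1 fst H0.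
apply: cen => -[x h]; apply/pair_equal_spec; split=> //=.
rewrite t0 !zero_lfunE addr0 subr0.
apply: (flag_gt he (leqnn _)); rewrite lieC; apply: flagN.
by apply: (adapted_lieS ae) => //; apply: (flag_frame he).
Qed.

Lemma listed_of_completable (K : numFieldType) (L : lieAlgType K) n :
  \dim {:L} = n -> filiform L -> completable L -> listed L n.
Proof.
move=> dn fL [t _ ct]; have [n2 [e ae]] := filiform_adapted dn fL.
have [n4|n5] := leqP n 4; first exact: listed_small ae n4.
have [D Dt D0] := complete_torus_neq0 ae n2 ct.
have [der diag _] := torusP t.
have [d0|d0] := eqVneq (co n e n ⁅e 2, e n.-1⁆) 0.
  have [Y1 [alpha [Y1n DY1]]] := exists_eigenvector_top ae n5 (der _ Dt) (diag _ Dt).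
  have [Y2 [beta [Y2F Y2n DY2]]] := exists_eigenvector_flag2 ae n5 (der _ Dt) (diag _ Dt).
  exact: (listed_of_delta0 ae Y2F n5 Y1n Y2n (der _ Dt) DY1 DY2 D0 d0).
(* D may act by 0 on its own Y_1 while another element of the torus does not, so the split ranges
   over the whole torus and h replaces D. *)
have [[h [Y1 [alpha [ht Y1n Y1c DY1 a0]]]]|Hno] := classic (exists h Y1 alpha,
    [/\ h \in (t : {vspace 'End(L)}), co n e 1 Y1 != 0,
      co n e 1 Y1 + co n e 2 Y1 * co n e n ⁅e 2, e n.-1⁆ = 0,
      h Y1 = alpha *: Y1 & alpha != 0]).
  have h0 : h != 0.
    apply: contra_neq a0 => h0; move: DY1; rewrite h0 zero_lfunE => /esym/eqP.
    rewrite scaler_eq0 => /orP[/eqP//|/eqP Y0].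
    by rewrite Y0 co0 eqxx in Y1n.
  have [Y2 [beta [Y2F Y2n DY2]]] := exists_eigenvector_flag2 ae n5 (der _ ht) (diag _ ht).
  exact: (listed_of_alpha ae n5 (der _ ht) DY1 DY2 Y2F Y1c d0 Y1n Y2n h0 a0).
have t0 h Y a : h \in (t : {vspace 'End(L)}) ->
    co n e 1 Y + co n e 2 Y * co n e n ⁅e 2, e n.-1⁆ = 0 -> co n e 1 Y != 0 ->
    h Y = a *: Y -> a = 0.
  move=> ht Yc Yn hY; apply: NNPP => /eqP a0; apply: Hno; by exists h, Y, a.
have [Y1 [alpha [Y1n Y1c DY1]]] := exists_eigenvector_centralizer ae n5 (der _ Dt) (diag _ Dt) d0.
have [Y2 [beta [Y2F Y2n DY2]]] := exists_eigenvector_flag2 ae n5 (der _ Dt) (diag _ Dt).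
have a0 := t0 _ _ _ Dt Y1c Y1n DY1; rewrite a0 in DY1.
by case: (degenerate_not_complete ae n5 d0 t0 Dt D0 DY1 DY2 Y1n Y2F Y2n Y1c).
Qed.

Lemma completable_of_listed (K : numFieldType) (L : lieAlgType K) n :
  listed L n -> completable L.
Proof.
case=> [|[p [_]]|[k [lam [a [adm]]]]|[k [lam [a [adm]]]]] /frame_of_iso[e he pe].
- exact: completable_L he pe.
- exact: completable_Q he pe.
- by have /andP[k2 _] := A_bounds adm; apply: completable_A k2 he pe.
- by have /andP[k2 _] := B_bounds adm; apply: completable_B k2 he pe.
Qed.

Theorem theorem5 (R : realType) (g : lieAlgType R[i]) (n r : nat)
    (hn : \dim {:g} = n) (hfil : filiform g) (hrank : has_rank g r)
    (hr : r <> 0%N) :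
  completable g <->
  [\/ g ≅ L_alg R[i] n,
      exists p, n = p.*2 /\ g ≅ Q_alg R[i] p,
      exists k (lam : (A_t n k).-1.-tuple R[i]) a (adm : A_admissible lam a),
        g ≅ A_alg adm |
      exists k (lam : (B_t n k).-1.-tuple R[i]) a (adm : B_admissible lam a),
        g ≅ B_alg adm].
Proof.
split; last exact: completable_of_listed.
exact: listed_of_completable.
Qed.
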